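(* Let $\nu\ge 2$ be an integer, let $\omega\in\mathbb{R}^{\nu}$ be non-resonant, and let $c,d:\mathbb{Z}^{\nu}\to\mathbb{C}$. Consider the quasi-periodic Cauchy problem $$u_{tt}-u_{xx}-u_{xxtt}-(u^2)_{xx}=0,\qquad u(0,x)=\sum_{n\in\mathbb{Z}^{\nu}}c(n)e^{i\langle n,\omega\rangle x},\qquad u_t(0,x)=\sum_{n\in\mathbb{Z}^{\nu}}d(n)e^{i\langle n,\omega\rangle x},\qquad x\in\mathbb{R}.$$ Assume that there exist $A>0$ and $0<\rho\le 1$ such that $$|c(n)|\le A e^{-\rho|n|},\qquad |d(n)|\le A e^{-\rho|n|},\qquad n\in\mathbb{Z}^{\nu}.$$ Set $$b_\rho:=(6\rho^{-1})^{\nu},\qquad M:=\max\{1,Ab_\rho\},\qquad B:=2M,\qquad L:=\frac{1}{5M}.$$ Then, on the time interval $[0,L]$, the Cauchy problem admits a classical spatially quasi-periodic solution of the form $$u(t,x)=\sum_{n\in\mathbb{Z}^{\nu}}\widehat u(t,n)e^{i\langle n,\omega\rangle x}$$ such that $$|\widehat u(t,n)|\le B e^{-\frac{\rho}{2}|n|},\qquad 0\le t\le L,\ n\in\mathbb{Z}^{\nu}.$$ Moreover, this solution is unique among all spatially quasi-periodic solutions of the Cauchy problem on $[0,L]$ (with the same frequency vector $\omega$) satisfying this exponential decay estimate.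
   Context: For $n=(n_1,\dots,n_\nu)\in\mathbb{Z}^\nu$, $|n|:=\sum_{j=1}^\nu|n_j|$ and $\langle n,\omega\rangle:=\sum_{j=1}^\nu n_j\omega_j$. The vector $\omega\in\mathbb{R}^\nu$ is non-resonant (rationally independent) if $\langle n,\omega\rangle=0$ with $n\in\mathbb{Z}^\nu$ implies $n=0$. A classical spatially quasi-periodic solution on $[0,L]$ with frequency vector $\omega$ is a function $u:[0,L]\times\mathbb{R}\to\mathbb{C}$ of the form $u(t,x)=\sum_{n\in\mathbb{Z}^\nu}\widehat u(t,n)e^{i\langle n,\omega\rangle x}$ for which the derivatives $u_t,u_{tt},u_{xx},u_{xxtt},(u^2)_{xx}$ exist as continuous functions on $[0,L]\times\mathbb{R}$ (one-sided in $t$ at the endpoints), the equation holds pointwise on $[0,L]\times\mathbb{R}$, and the two initial conditions hold pointwise. *)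

(* Defs.v *)
From Stdlib Require Import Reals.
From Coquelicot Require Import Coquelicot.
From mathcomp Require Import all_boot finmap ssrZ.

Set Implicit Arguments.
Unset Strict Implicit.
Unset Printing Implicit Defensive.

Local Open Scope R_scope.

Definition Zvec (nu : nat) : Type := {ffun 'I_nu -> Z}.

Definition l1norm (nu : nat) (n : Zvec nu) : R :=
  \big[Rplus/0]_(j < nu) Rabs (IZR (n j)).

Definition pairing (nu : nat) (n : Zvec nu) (omega : 'I_nu -> R) : R :=
  \big[Rplus/0]_(j < nu) (IZR (n j) * omega j).

Definition nonresonant (nu : nat) (omega : 'I_nu -> R) : Prop :=
  forall n : Zvec nu, pairing n omega = 0 -> forall j, n j = 0%Z.

Definition cis (theta : R) : C := (cos theta, sin theta).

(* The filter of finite subsets of T directed by inclusion: convergence of the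
   finite partial sums along it is unconditional summability, so no enumeration
   of the index set is chosen. *)
Definition totally (T : choiceType) (P : {fset T} -> Prop) : Prop :=
  exists F0 : {fset T}, forall F : {fset T}, fsubset F0 F -> P F.

Definition is_sum (T : choiceType) (a : T -> C) (s : C) : Prop :=
  filterlim (fun F : {fset T} => \big[Cplus/RtoC 0]_(n <- F) a n)
    (@totally T) (locally s).

Definition is_qp_series (nu : nat) (omega : 'I_nu -> R) (a : Zvec nu -> C)
    (x : R) (s : C) : Prop :=
  is_sum (T := {ffun 'I_nu -> Z})
    (fun n => Cmult (a n) (cis (pairing n omega * x))) s.

(* Derivatives of C-valued functions of a real variable, C being a normed space
   over R.  The one in time is taken within [0, L], hence is one-sided at the
   endpoints; values of f outside [0, L] are irrelevant. *)
Definition is_derive_x (f : R -> C) (x : R) (l : C) : Prop :=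
  is_derive (V := C_R_NormedModule) f x l.

Definition is_derive_t (L : R) (f : R -> C) (t : R) (l : C) : Prop :=
  filterdiff (U := R_NormedModule) (V := C_R_NormedModule) f
    (within (fun s => 0 <= s <= L) (locally t)) (fun h => scal h l).

Definition partial_x (L : R) (f g : R -> R -> C) : Prop :=
  forall t x, 0 <= t <= L -> is_derive_x (fun y => f t y) x (g t x).

Definition partial_t (L : R) (f g : R -> R -> C) : Prop :=
  forall t x, 0 <= t <= L -> is_derive_t L (fun s => f s x) t (g t x).

Definition continuous_strip (L : R) (g : R -> R -> C) : Prop :=
  continuous_on (fun p : R * R => 0 <= fst p <= L)
    (fun p : R * R => g (fst p) (snd p)).

(* Only u_t, u_tt, u_xx, u_xxtt and (u^2)_xx are required to be continuous; the
   intermediate derivatives u_x, u_xxt and (u^2)_x merely exist.  u_xxtt is the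
   second time derivative of u_xx. *)
Definition classical_solution (nu : nat) (omega : 'I_nu -> R)
    (c d : Zvec nu -> C) (L : R) (u : R -> R -> C) : Prop :=
  exists ut utt ux uxx uxxt uxxtt sqx sqxx : R -> R -> C,
    (partial_t L u ut /\ partial_t L ut utt) /\
    (partial_x L u ux /\ partial_x L ux uxx) /\
    (partial_t L uxx uxxt /\ partial_t L uxxt uxxtt) /\
    (partial_x L (fun t x => Cmult (u t x) (u t x)) sqx /\
     partial_x L sqx sqxx) /\
    (continuous_strip L ut /\ continuous_strip L utt /\
     continuous_strip L uxx /\ continuous_strip L uxxtt /\
     continuous_strip L sqxx) /\
    (forall t x, 0 <= t <= L ->
       (utt t x - uxx t x - uxxtt t x - sqxx t x)%C = RtoC 0) /\
    (forall x, is_qp_series omega c x (u 0 x)) /\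
    (forall x, is_qp_series omega d x (ut 0 x)).

Definition qp_expansion (nu : nat) (omega : 'I_nu -> R) (L : R)
    (u : R -> R -> C) (uhat : R -> Zvec nu -> C) : Prop :=
  forall t x, 0 <= t <= L -> is_qp_series omega (uhat t) x (u t x).

Definition classical_qp_solution (nu : nat) (omega : 'I_nu -> R)
    (c d : Zvec nu -> C) (L : R) (u : R -> R -> C)
    (uhat : R -> Zvec nu -> C) : Prop :=
  qp_expansion omega L u uhat /\ classical_solution omega c d L u.

Definition exp_decay (nu : nat) (L B kappa : R) (uhat : R -> Zvec nu -> C) : Prop :=
  forall t n, 0 <= t <= L -> Cmod (uhat t n) <= B * exp (- kappa * l1norm n).

(* Main.v *)
Require Import Defs.
From HB Require Import structures.
From Stdlib Require Import ZArith Reals Lra Lia ClassicalEpsilon FunctionalExtensionality.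
From Coquelicot Require Import Coquelicot.
From mathcomp Require Import all_boot finmap ssrZ zify.

Set Implicit Arguments.
Unset Strict Implicit.
Unset Printing Implicit Defensive.
Local Open Scope R_scope.

(** Write [q = <n, omega>].  On Fourier coefficients the equation reads
    [(1 + q^2) u'' = - q^2 (u + u * u)], where [*] is convolution.  The symbol
    [q^2 / (1 + q^2)] lies in [[0, 1]], so no derivative is lost: this is an
    ordinary differential equation with a bounded quadratic right-hand side in a
    weighted l^1 algebra, and its solution is analytic in time.

    Existence.  The solution is looked for as a power series in time, that is as a
    family [a (k, n)] of coefficients of the monomials [t^k exp(i q x)].  These
    monomials are characters of the additive monoid of pairs [(k, n)], so a product
    of series is the series of the convolution of the coefficients
    ([qseries_conv]), and the equation turns into the recursion [step].  In the
    norm with weight [r^k exp(rho/2 |n|)], [r = 2 L], the data have norm at most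
    [M], because the sum over [n] of [exp(- rho/2 |n|)] is at most [(6/rho)^nu]
    ([exp_decay_sum]), and the recursion preserves the ball of radius [2 M]
    ([step_wbound]).  Since a coefficient of index [k] only depends on smaller
    indices, iterating the recursion from zero stabilizes, and the limit
    [sol_coef] lies in the same ball.  The radius [2 L > L] and the exponential
    weight leave room to differentiate termwise as often as needed
    ([qseries_derive_t], [qseries_derive_x]), so the differential equation reduces
    to an identity between coefficients ([coefficient_equation]).  Collecting the
    terms with a fixed frequency gives the Fourier coefficients and their decay
    ([coef_decay]); all these rearrangements are instances of [is_sum_regroup].

    Uniqueness.  It holds among all bounded classical solutions, and the proof
    works in physical space.  For two solutions with the same data, the difference
    [z] satisfies [z_tt - z_xxtt = h_xx], where [h = z + v^2 - u^2] obeys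
    [|h| <= K |z|].  Integrating twice in time, with
    [H(t) = int_0^t (t - s) h(s) ds], gives [z - z_xx = H_xx], that is
    [y - y_xx = H] for [y = z + H].  A maximum principle for bounded functions on
    the line ([max_principle]) yields [|y| <= sup |H|], hence [|z| <= 2 sup |H|]
    ([linear_estimate]).  If [|h|] is at most [G exp(mu t)], then [|H|] is at most
    [G exp(mu t) / mu^2]; for [mu] large this improves any bound on [z] by a factor
    [1/2], so that [z = 0] ([bounded_uniqueness]).  The one delicate point is that
    [z_xxt] vanishes initially, since the data only prescribe [z] and [z_t]
    ([initial_velocity_xx]). *)

(** * Finite sums *)

Fact Rplus_monoid_assoc : associative Rplus.
Proof. by move=> x y z; ring. Qed.
Fact Rplus_monoid_comm : commutative Rplus.
Proof. by move=> x y; ring. Qed.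
Fact Rplus_monoid_id : left_id 0 Rplus.
Proof. by move=> x; ring. Qed.
HB.instance Definition _ :=
  Monoid.isComLaw.Build R 0 Rplus Rplus_monoid_assoc Rplus_monoid_comm Rplus_monoid_id.
Fact Rmult_monoid_assoc : associative Rmult.
Proof. by move=> x y z; ring. Qed.
Fact Rmult_monoid_comm : commutative Rmult.
Proof. by move=> x y; ring. Qed.
Fact Rmult_monoid_id : left_id 1 Rmult.
Proof. by move=> x; ring. Qed.
HB.instance Definition _ :=
  Monoid.isComLaw.Build R 1 Rmult Rmult_monoid_assoc Rmult_monoid_comm Rmult_monoid_id.
Fact Rmult_monoid_zero_l : left_zero 0 Rmult.
Proof. by move=> x; ring. Qed.
Fact Rmult_monoid_zero_r : right_zero 0 Rmult.
Proof. by move=> x; ring. Qed.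
HB.instance Definition _ :=
  Monoid.isMulLaw.Build R 0 Rmult Rmult_monoid_zero_l Rmult_monoid_zero_r.
Fact Rmult_plus_left : left_distributive Rmult Rplus.
Proof. by move=> x y z; ring. Qed.
Fact Rmult_plus_right : right_distributive Rmult Rplus.
Proof. by move=> x y z; ring. Qed.
HB.instance Definition _ :=
  Monoid.isAddLaw.Build R Rmult Rplus Rmult_plus_left Rmult_plus_right.
Fact Cplus_monoid_assoc : associative Cplus.
Proof. by move=> x y z; ring. Qed.
Fact Cplus_monoid_comm : commutative Cplus.
Proof. by move=> x y; ring. Qed.
Fact Cplus_monoid_id : left_id (RtoC 0) Cplus.
Proof. by move=> x; ring. Qed.
HB.instance Definition _ :=
  Monoid.isComLaw.Build C (RtoC 0) Cplus Cplus_monoid_assoc Cplus_monoid_comm Cplus_monoid_id.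

Notation rsum F f := (\big[Rplus/0]_(i <- F) f i).
Notation csum F f := (\big[Cplus/RtoC 0]_(i <- F) f i).

Section FiniteSums.
Variable T : choiceType.
Implicit Types (F G : {fset T}) (s : seq T).

Lemma rsum_le s (f g : T -> R) : (forall i, f i <= g i) -> rsum s f <= rsum s g.
Proof.
move=> h; elim: s => [|i s IH]; rewrite ?big_nil ?big_cons; first by lra.
by have := h i; lra.
Qed.

Lemma rsum_ge0 s (f : T -> R) : (forall i, 0 <= f i) -> 0 <= rsum s f.
Proof.
move=> h; elim: s => [|i s IH]; rewrite ?big_nil ?big_cons; first by lra.
by have := h i; lra.
Qed.

Lemma rsum_scal s (c : R) (f : T -> R) : rsum s (fun i => c * f i) = c * rsum s f.
Proof. by elim: s => [|i s IH]; rewrite ?big_nil ?big_cons ?IH; ring. Qed.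

Lemma csum_scal s (c : C) (f : T -> C) :
  csum s (fun i => Cmult c (f i)) = Cmult c (csum s f).
Proof. by elim: s => [|i s IH]; rewrite ?big_nil ?big_cons ?IH; ring. Qed.

Lemma csum_plus s (f g : T -> C) :
  csum s (fun i => Cplus (f i) (g i)) = Cplus (csum s f) (csum s g).
Proof. by elim: s => [|i s IH]; rewrite ?big_nil ?big_cons ?IH; ring. Qed.

Lemma Cmod_csum_le s (f : T -> C) : Cmod (csum s f) <= rsum s (fun i => Cmod (f i)).
Proof.
elim: s => [|i s IH]; rewrite ?big_nil ?big_cons; first by rewrite Cmod_0; lra.
by have := Cmod_triangle (f i) (csum s f); lra.
Qed.

Lemma big_fset_sub (R0 : Type) (idx : R0) (op : Monoid.com_law idx) F G (f : T -> R0) :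
  fsubset F G ->
  \big[op/idx]_(i <- G) f i =
  op (\big[op/idx]_(i <- F) f i) (\big[op/idx]_(i <- fsetD G F) f i).
Proof.
move=> sFG; rewrite (big_fsetID _ (fun i => i \in F)) /=; congr (op _ _).
  apply: eq_fbigl => i; rewrite !inE /=.
  by apply/andP/idP => [[]//|iF]; split => //; apply: (fsubsetP sFG).
by apply: eq_fbigl => i; rewrite !inE /= andbC.
Qed.

Lemma rsum_sub F G (f : T -> R) :
  fsubset F G -> rsum G f = rsum F f + rsum (fsetD G F) f.
Proof. exact: big_fset_sub. Qed.

Lemma csum_sub F G (f : T -> C) :
  fsubset F G -> csum G f = Cplus (csum F f) (csum (fsetD G F) f).
Proof. exact: big_fset_sub. Qed.

Lemma rsum_mono F G (f : T -> R) :
  (forall i, 0 <= f i) -> fsubset F G -> rsum F f <= rsum G f.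
Proof.
move=> f0 sF; rewrite (rsum_sub _ sF).
by have := rsum_ge0 (fsetD G F) f0; lra.
Qed.

End FiniteSums.

(** * Unconditional summation *)

(** Absolute summability with an explicit bound, stated on finite partial sums so
    that no value has to be assigned to an infinite sum of reals. *)
Definition abs_bound (T : choiceType) (f : T -> C) (S : R) : Prop :=
  forall F : {fset T}, rsum F (fun i => Cmod (f i)) <= S.

Lemma Cmod_components (z : C) :
  Rabs (fst z) <= Cmod z /\ Rabs (snd z) <= Cmod z /\
  Cmod z <= Rabs (fst z) + Rabs (snd z).
Proof.
have [h1 h2] : Rabs (fst z) <= Cmod z /\ Rabs (snd z) <= Cmod z.
  have := Rmax_Cmod z.
  by have := Rmax_l (Rabs (fst z)) (Rabs (snd z));
     have := Rmax_r (Rabs (fst z)) (Rabs (snd z)); lra.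
split=> //; split=> //.
have -> : z = Cplus (RtoC (fst z)) (Cmult (RtoC (snd z)) Ci).
  by case: z {h1 h2} => x y; rewrite /Cplus /Cmult /RtoC /=; congr (_, _); ring.
apply: Rle_trans (Cmod_triangle _ _) _.
rewrite Cmod_mult !Cmod_R /= Cmod_Ci.
have -> : fst z + (snd z * 0 - 0 * 1) = fst z by ring.
have -> : 0 + (snd z * 1 + 0 * 0) = snd z by ring.
lra.
Qed.

Section Summation.
Variable T : choiceType.
Implicit Types (F G : {fset T}) (f g : T -> C) (s : C).

Lemma totally_proper : ProperFilter (@totally T).
Proof.
split=> [P [F0 h]|]; first by exists F0; apply: h.
split=> [|P Q [F0 h0] [F1 h1]|P Q h [F0 h0]].
- by exists fset0.
- exists (fsetU F0 F1) => F; rewrite fsubUset => /andP [a b].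
  by split; [apply: h0|apply: h1].
- by exists F0 => F /h0 /h.
Qed.

(** The ball of the product uniform structure on [C] is a square, which is comparable to
    the disc of [Cmod]; hence convergence may be tested with the modulus. *)
Lemma is_sumP f s :
  is_sum f s <->
  forall e : R, 0 < e ->
    exists F0, forall F, fsubset F0 F -> Cmod (Cminus (csum F f) s) < e.
Proof.
split=> [h e e0|h P [e he]].
  have e2 : 0 < e / 2 by lra.
  have [F0 hF] := h _ (@locally_ball C_UniformSpace s (mkposreal _ e2)).
  exists F0 => F /hF [b1 b2].
  have [_ [_ h3]] := Cmod_components (Cminus (csum F f) s).
  move: b1 b2 h3; rewrite /ball /= /AbsRing_ball /abs /minus /plus /opp /=; lra.
have [F0 hF] := h _ (cond_pos e).
exists F0 => F /hF hc; apply: he.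
have [h1 [h2 _]] := Cmod_components (Cminus (csum F f) s).
by split; rewrite /ball /= /AbsRing_ball /abs /minus /plus /opp /=; move: h1 h2; simpl; lra.
Qed.

Lemma Cmod_small_eq (a b : C) : (forall e, 0 < e -> Cmod (Cminus a b) < e) -> a = b.
Proof.
move=> h; have z : Cminus a b = RtoC 0.
  apply: Cmod_eq_0; have p := Cmod_ge_0 (Cminus a b).
  case: (Rle_lt_or_eq_dec _ _ p) => [q|//].
  by have := h _ q; lra.
have -> : a = Cplus (Cminus a b) b by ring.
by rewrite z; ring.
Qed.

Lemma is_sum_unique f s1 s2 : is_sum f s1 -> is_sum f s2 -> s1 = s2.
Proof.
move=> /is_sumP h1 /is_sumP h2; apply: Cmod_small_eq => e e0.
have e2 : 0 < e / 2 by lra.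
have [F1 k1] := h1 _ e2; have [F2 k2] := h2 _ e2.
have := k1 _ (fsubsetUl F1 F2); have := k2 _ (fsubsetUr F1 F2).
set x := csum _ _ => q1 q2.
have -> : Cminus s1 s2 = Cplus (Copp (Cminus x s1)) (Cminus x s2) by ring.
by have := Cmod_triangle (Copp (Cminus x s1)) (Cminus x s2); rewrite Cmod_opp; lra.
Qed.

Lemma is_sum_ext f g s : (forall i, f i = g i) -> is_sum f s -> is_sum g s.
Proof. by move=> /functional_extensionality ->. Qed.

Lemma abs_bound_le f g S :
  (forall i, Cmod (f i) <= Cmod (g i)) -> abs_bound g S -> abs_bound f S.
Proof. by move=> h k F; apply: Rle_trans (k F); apply: rsum_le. Qed.

Lemma abs_bound_ge0 f S : abs_bound f S -> 0 <= S.
Proof. by move/(_ fset0); rewrite big_seq_fset0. Qed.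

Lemma abs_bound_term f S i : abs_bound f S -> Cmod (f i) <= S.
Proof. by move/(_ (fset1 i)); rewrite big_seq_fset1. Qed.

Lemma is_sum_bound f s S : is_sum f s -> abs_bound f S -> Cmod s <= S.
Proof.
move=> /is_sumP h k; apply: le_epsilon => e e0.
have [F hF] := h _ e0.
have := hF F (fsubset_refl F); have := k F; have := Cmod_csum_le F f.
set x := csum _ _ => q1 q2 q3.
have -> : s = Cplus (Copp (Cminus x s)) x by ring.
by have := Cmod_triangle (Copp (Cminus x s)) x; rewrite Cmod_opp; lra.
Qed.

Lemma is_sum_scal f s c : is_sum f s -> is_sum (fun i => Cmult c (f i)) (Cmult c s).
Proof.
move=> /is_sumP h; apply/is_sumP => e e0.
have c0 := Cmod_ge_0 c.
have e1 : 0 < e / (Cmod c + 1) by apply: Rdiv_lt_0_compat; lra.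
have [F0 hF] := h _ e1; exists F0 => F /hF {hF h}.
rewrite csum_scal; set x := csum _ _ => hx.
have -> : Cminus (Cmult c x) (Cmult c s) = Cmult c (Cminus x s) by ring.
rewrite Cmod_mult.
have h2 : (Cmod c + 1) * Cmod (Cminus x s) < e.
  have -> : e = (Cmod c + 1) * (e / (Cmod c + 1)) by field; lra.
  by apply: Rmult_lt_compat_l => //; lra.
have := Cmod_ge_0 (Cminus x s); nra.
Qed.

Lemma is_sum_plus f g s1 s2 :
  is_sum f s1 -> is_sum g s2 -> is_sum (fun i => Cplus (f i) (g i)) (Cplus s1 s2).
Proof.
move=> /is_sumP h1 /is_sumP h2; apply/is_sumP => e e0.
have e2 : 0 < e / 2 by lra.
have [F1 k1] := h1 _ e2; have [F2 k2] := h2 _ e2.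
exists (fsetU F1 F2) => F; rewrite fsubUset csum_plus => /andP [/k1 q1 /k2 q2].
move: q1 q2; set x := csum _ f; set y := csum _ g => q1 q2.
have -> : Cminus (Cplus x y) (Cplus s1 s2) = Cplus (Cminus x s1) (Cminus y s2) by ring.
by have := Cmod_triangle (Cminus x s1) (Cminus y s2); lra.
Qed.

Lemma is_sum_0 : is_sum (fun _ : T => RtoC 0) (RtoC 0).
Proof.
apply/is_sumP => e e0; exists fset0 => F _.
rewrite big1 //.
by rewrite /Cminus Cplus_opp_r Cmod_0.
Qed.

Lemma is_sum_finite (J : choiceType) (r : seq J) (f : J -> T -> C) (s : J -> C) :
  (forall j, is_sum (f j) (s j)) -> is_sum (fun i => csum r (fun j => f j i)) (csum r s).
Proof.
move=> h; elim: r => [|j r IH].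
  by rewrite big_nil; apply: is_sum_ext is_sum_0 => i; rewrite big_nil.
rewrite big_cons; apply: is_sum_ext (is_sum_plus (h j) IH) => i.
by rewrite big_cons.
Qed.

Lemma is_sum_single f i0 : (forall i, i != i0 -> f i = RtoC 0) -> is_sum f (f i0).
Proof.
move=> h; apply/is_sumP => e e0; exists (fset1 i0) => F sF.
rewrite (csum_sub _ sF) big_seq_fset1.
rewrite big_seq big1 => [|i]; last by rewrite !inE => /andP [/h].
rewrite Cplus_0_r /Cminus Cplus_opp_r Cmod_0 //.
Qed.

(** An absolutely bounded family has arbitrarily small tails: take a finite set
    whose partial sum of moduli comes close to the supremum. *)
Lemma abs_bound_tail f S e :
  abs_bound f S -> 0 < e ->
  exists F0, forall F, [disjoint F0 & F]%fset -> rsum F (fun i => Cmod (f i)) < e.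
Proof.
move=> h e0.
pose E x := exists F, x = rsum F (fun i => Cmod (f i)).
have [m [ub lub]] : {m | is_lub E m}.
  apply: completeness; first by exists S => x [F ->].
  by exists (rsum fset0 (fun i => Cmod (f i))), fset0.
have [F0 hF0] : exists F0, m - e < rsum F0 (fun i => Cmod (f i)).
  apply: NNPP => hn.
  have : m <= m - e; last by lra.
  apply: lub => x [F ->]; apply: Rnot_lt_le => hl; apply: hn; by exists F.
exists F0 => F dF.
have : rsum (fsetU F0 F) (fun i => Cmod (f i)) <= m by apply: ub; exists (fsetU F0 F).
rewrite (rsum_sub _ (fsubsetUl F0 F)).
have -> : fsetD (fsetU F0 F) F0 = F.
  apply/fsetP => i; rewrite !inE.
  case: (boolP (i \in F0)) => //= iF0.
  by apply/esym/negbTE; apply: (fdisjointP dF).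
by lra.
Qed.

Lemma fdisjointD F G : [disjoint F & fsetD G F]%fset.
Proof. by apply/fdisjointP => i iF; rewrite !inE iF. Qed.

(** Completeness is used on the real and imaginary parts separately: the tail
    estimate makes the partial sums Cauchy. *)
Lemma abs_bound_summable f S : abs_bound f S -> exists s, is_sum f s.
Proof.
move=> h.
have cauchy (pr : C -> R) :
  (forall z, Rabs (pr z) <= Cmod z) -> (forall a b, pr (Cminus a b) = pr a - pr b) ->
  exists x, forall e, 0 < e -> exists F0, forall F, fsubset F0 F -> Rabs (pr (csum F f) - x) < e.
  move=> p1 p2.
  have [x hx] : exists y, filterlim (fun F => pr (csum F f)) (@totally T) (locally y).
    apply: (proj1 (@filterlim_locally_cauchy _ R_CompleteSpace _ totally_proper _)) => e.
    have e2 : 0 < e / 2 by have := cond_pos e; lra.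
    have [F0 hF] := abs_bound_tail h e2.
    have k F : fsubset F0 F -> Rabs (pr (csum F f) - pr (csum F0 f)) < e / 2.
      move=> sF; rewrite -p2; apply: Rle_lt_trans (p1 _) _.
      rewrite (csum_sub _ sF).
      have q := hF _ (fdisjointD F0 F).
      apply: Rle_lt_trans q; apply: Rle_trans (Cmod_csum_le _ _).
      by apply: Req_le; congr Cmod; ring.
    exists (fun F => fsubset F0 F); split=> [|u v hu hv]; first by exists F0.
    have q1 := k u hu; have q2 := k v hv.
    rewrite /ball /= /AbsRing_ball /abs /minus /plus /opp /=.
    by move: q1 q2; rewrite /Rabs; do 3 case: Rcase_abs; lra.
  exists x => e e0.
  have [F0 hF] := hx _ (@locally_ball R_UniformSpace x (mkposreal _ e0)).
  by exists F0 => F /hF.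
have [x hx] := cauchy fst (fun z => proj1 (Cmod_components z)) (fun a b => erefl).
have [y hy] := cauchy snd (fun z => proj1 (proj2 (Cmod_components z))) (fun a b => erefl).
exists (x, y); apply/is_sumP => e e0.
have e2 : 0 < e / 2 by lra.
have [F1 k1] := hx _ e2; have [F2 k2] := hy _ e2.
exists (fsetU F1 F2) => F; rewrite fsubUset => /andP [/k1 q1 /k2 q2].
have [_ [_ q3]] := Cmod_components (Cminus (csum F f) (x, y)).
by apply: Rle_lt_trans q3 _; rewrite /=; move: q1 q2; rewrite /Rminus; lra.
Qed.

(** Meaningful only for summable families, where [Sum_correct] identifies it. *)
Definition Sum f : C := epsilon (inhabits (RtoC 0)) (is_sum f).

Lemma Sum_unique f s : is_sum f s -> Sum f = s.
Proof.
move=> h; apply: (@is_sum_unique f) => //.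
by apply: epsilon_spec; exists s.
Qed.

Lemma Sum_correct f S : abs_bound f S -> is_sum f (Sum f).
Proof. by move/abs_bound_summable => [s hs]; rewrite (Sum_unique hs). Qed.

End Summation.

Section Regrouping.
Variables I J : choiceType.

Definition fiber (p : I -> J) (f : I -> C) (j : J) : I -> C :=
  fun i => if p i == j then f i else RtoC 0.

Lemma abs_bound_fiber p f S j : abs_bound f S -> abs_bound (fiber p f j) S.
Proof.
apply: abs_bound_le => i; rewrite /fiber; case: ifP => _; first by lra.
by rewrite Cmod_0; apply: Cmod_ge_0.
Qed.

Lemma csum_fiber (G : {fset J}) p (f : I -> C) i :
  csum G (fun j => fiber p f j i) = if p i \in G then f i else RtoC 0.
Proof.
rewrite /fiber; case: ifP => h.
  rewrite (big_fsetD1 (p i)) //= eqxx big_seq big1 ?Cplus_0_r // => j.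
  by rewrite !inE eq_sym => /andP [/negbTE ->].
rewrite big_seq big1 // => j jG; case: eqP => // e.
by rewrite -e h in jG.
Qed.

Lemma rsum_fiber (G : {fset J}) p (f : I -> C) i :
  rsum G (fun j => Cmod (fiber p f j i)) = if p i \in G then Cmod (f i) else 0.
Proof.
rewrite /fiber; case: ifP => h.
  rewrite (big_fsetD1 (p i)) //= eqxx big_seq big1 /=; first by lra.
  by move=> j; rewrite !inE eq_sym => /andP [/negbTE -> _]; rewrite Cmod_0.
rewrite big_seq big1 // => j jG; case: eqP => // e.
  by rewrite -e h in jG.
by rewrite Cmod_0.
Qed.

(** Summing first over the fibres of a map does not change an absolutely
    convergent sum: past the image of a finite set with small tail, only terms of
    that tail are missing. *)
Lemma is_sum_regroup p f S s (g : J -> C) :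
  abs_bound f S -> is_sum f s -> (forall j, is_sum (fiber p f j) (g j)) -> is_sum g s.
Proof.
move=> hb hs hg; apply/is_sumP => e e0.
have e2 : 0 < e / 2 by lra.
have [F0 hF] := abs_bound_tail hb e2.
exists [fset p i | i in F0]%fset => G sG.
have h1 := is_sum_finite (r := G) hg.
have h2 := is_sum_plus h1 (is_sum_scal (c := Copp (RtoC 1)) hs).
have -> : Cminus (csum G g) s = Cplus (csum G g) (Cmult (Copp (RtoC 1)) s).
  by ring.
apply: Rle_lt_trans (_ : e / 2 < e); last by lra.
apply: (is_sum_bound h2) => F.
have k : fsubset (fsetI F F0) F by rewrite fsubsetIl.
rewrite (rsum_sub _ k) big_seq big1 => [|i].
  apply: Rle_trans (_ : rsum (fsetD F (fsetI F F0)) (fun i => Cmod (f i)) <= _).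
    rewrite /= Rplus_0_l; apply: rsum_le => i; rewrite csum_fiber.
    case: ifP => _.
      rewrite (_ : Cplus _ _ = RtoC 0) ?Cmod_0; first exact: Cmod_ge_0.
      by ring.
    by rewrite Cplus_0_l Cmod_mult Cmod_opp Cmod_1; lra.
  apply/Rlt_le/hF/fdisjointP => i iF0; rewrite !inE iF0 andbT.
  by case: (i \in F).
rewrite !inE csum_fiber => /andP [_ iF0].
rewrite (fsubsetP sG) ?in_imfset //.
rewrite (_ : Cplus _ _ = RtoC 0) ?Cmod_0 //.
by ring.
Qed.

(** The moduli of finitely many fibre sums are approximated by moduli of partial sums
    over one common finite set, whose fibres are disjoint. *)
Lemma abs_bound_regroup p f S (g : J -> C) :
  abs_bound f S -> (forall j, is_sum (fiber p f j) (g j)) -> abs_bound g S.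
Proof.
move=> hb hg G; apply: le_epsilon => e e0.
pose N := rsum G (fun _ => 1).
have N0 : 0 <= N by apply: rsum_ge0 => _; lra.
have e1 : 0 < e / (N + 1) by apply: Rdiv_lt_0_compat; lra.
(* One finite set approximates all the finitely many fibre sums at once. *)
have [F hF] : exists F : {fset I}, forall j, j \in G ->
    Cmod (Cminus (csum F (fiber p f j)) (g j)) < e / (N + 1).
  have : exists F0 : {fset I}, forall F, fsubset F0 F -> forall j, j \in (G : seq J) ->
      Cmod (Cminus (csum F (fiber p f j)) (g j)) < e / (N + 1).
    elim: (G : seq J) => [|j r [F0 IH]]; first by exists fset0.
    have [F1 h1] := proj1 (is_sumP _ _) (hg j) _ e1.
    exists (fsetU F0 F1) => F; rewrite fsubUset => /andP [/IH a /h1 b] k.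
    by rewrite inE => /orP [/eqP -> //|/a].
  by move=> [F0 h]; exists F0; apply: h.
apply: Rle_trans (_ : rsum G (fun j => rsum F (fun i => Cmod (fiber p f j i)) + e / (N + 1)) <= _).
  have -> : rsum G (fun j => Cmod (g j)) = \big[Rplus/0]_(j <- G | j \in G) Cmod (g j).
    by rewrite [in LHS]big_seq.
  rewrite [X in _ <= X]big_seq.
  apply: (big_ind2 Rle) => [||j jG]; [by lra | by move=> *; lra |].
  have := hF j jG; have := Cmod_csum_le F (fiber p f j).
  set x := csum _ _ => q1 q2.
  have -> : g j = Cplus (Copp (Cminus x (g j))) x by ring.
  by have := Cmod_triangle (Copp (Cminus x (g j))) x; rewrite Cmod_opp; lra.
rewrite big_split /= exchange_big /=.
apply: Rplus_le_compat.
  apply: Rle_trans (hb F); apply: rsum_le => i; rewrite rsum_fiber.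
  by case: ifP => _; [lra | apply: Cmod_ge_0].
have -> : rsum G (fun _ => e / (N + 1)) = (e / (N + 1)) * N.
  by rewrite /N -rsum_scal; apply: eq_bigr => j _; ring.
apply: Rle_trans (_ : e / (N + 1) * (N + 1) <= _); last by apply: Req_le; field; lra.
by apply: Rmult_le_compat_l; lra.
Qed.

End Regrouping.

Section Products.
Variables I J : choiceType.

Lemma big_fset_prod (R0 : Type) (idx : R0) (op : Monoid.com_law idx)
  (F : {fset I}) (G : {fset J}) (f : I * J -> R0) :
  \big[op/idx]_(p <- fsetM F G) f p =
  \big[op/idx]_(i <- F) \big[op/idx]_(j <- G) f (i, j).
Proof. by rewrite big_imfset2 //= => -[x1 x2] [y1 y2] _ _ /= [-> ->]. Qed.

Lemma abs_bound_prod f g S1 S2 :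
  abs_bound f S1 -> abs_bound g S2 ->
  abs_bound (fun p : I * J => Cmult (f p.1) (g p.2)) (S1 * S2).
Proof.
move=> h1 h2 F.
pose F1 := [fset p.1 | p in F]%fset; pose F2 := [fset p.2 | p in F]%fset.
have sF : fsubset F (fsetM F1 F2).
  apply/fsubsetP => -[i j] ijF; rewrite in_fsetM.
  by apply/andP; split; apply/imfsetP; exists (i, j).
apply: Rle_trans (rsum_mono (fun p => Cmod_ge_0 _) sF) _.
rewrite big_fset_prod /=.
apply: Rle_trans (_ : rsum F1 (fun i => S2 * Cmod (f i)) <= _).
  apply: rsum_le => i.
  under eq_bigr => j _ do rewrite Cmod_mult.
  rewrite rsum_scal Rmult_comm; apply: Rmult_le_compat_r (h2 F2); exact: Cmod_ge_0.
rewrite rsum_scal Rmult_comm; apply: Rmult_le_compat_r (h1 F1).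
exact: abs_bound_ge0 h2.
Qed.

(** The product of two absolutely convergent sums is the sum over pairs, as is
    seen on rectangles, whose partial sums factor. *)
Lemma is_sum_prod f g S1 S2 s1 s2 :
  abs_bound f S1 -> abs_bound g S2 -> is_sum f s1 -> is_sum g s2 ->
  is_sum (fun p : I * J => Cmult (f p.1) (g p.2)) (Cmult s1 s2).
Proof.
move=> b1 b2 h1 h2.
have [s hs] := abs_bound_summable (abs_bound_prod b1 b2).
suff -> : Cmult s1 s2 = s by [].
apply: Cmod_small_eq => e e0.
have m1 := is_sum_bound h1 b1; have m2 := is_sum_bound h2 b2.
have S10 := abs_bound_ge0 b1; have S20 := abs_bound_ge0 b2.
pose d := e / (2 * (S1 + S2 + 1)).
have d0 : 0 < d by apply: Rdiv_lt_0_compat; lra.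
have e2 : 0 < e / 2 by lra.
have [F0 hF] := proj1 (is_sumP _ _) hs _ e2.
have [F1 hF1] := proj1 (is_sumP _ _) h1 _ d0.
have [F2 hF2] := proj1 (is_sumP _ _) h2 _ d0.
pose G1 := fsetU F1 [fset p.1 | p in F0]%fset.
pose G2 := fsetU F2 [fset p.2 | p in F0]%fset.
have sF : fsubset F0 (fsetM G1 G2).
  apply/fsubsetP => -[i j] ijF; rewrite in_fsetM; apply/andP.
  by split; rewrite inE; apply/orP; right; apply/imfsetP; exists (i, j).
have := hF _ sF; have := hF1 G1 (fsubsetUl _ _); have := hF2 G2 (fsubsetUl _ _).
rewrite big_fset_prod /=.
have -> : csum G1 (fun i => csum G2 (fun j => Cmult (f i) (g j))) = Cmult (csum G1 f) (csum G2 g).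
  rewrite Cmult_comm -csum_scal; apply: eq_bigr => i _.
  by rewrite csum_scal Cmult_comm.
have q1 : Cmod (csum G1 f) <= S1 by apply: Rle_trans (Cmod_csum_le _ _) (b1 _).
move: q1; set x := csum G1 f; set y := csum G2 g => q1 q2 q3 q4.
have -> : Cminus (Cmult s1 s2) s =
  Cplus (Cminus (Cmult x y) s)
   (Copp (Cplus (Cmult x (Cminus y s2)) (Cmult s2 (Cminus x s1)))) by ring.
apply: Rle_lt_trans (Cmod_triangle _ _) _; rewrite Cmod_opp.
have q5 := Cmod_triangle (Cmult x (Cminus y s2)) (Cmult s2 (Cminus x s1)).
rewrite !Cmod_mult in q5.
have q6 : Cmod x * Cmod (Cminus y s2) <= S1 * d.
  by apply: Rmult_le_compat => //; try apply: Cmod_ge_0; lra.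
have q7 : Cmod s2 * Cmod (Cminus x s1) <= S2 * d.
  by apply: Rmult_le_compat => //; try apply: Cmod_ge_0; lra.
have : (S1 + S2) * d <= e / 2; last by lra.
have -> : e / 2 = (S1 + S2 + 1) * d by rewrite /d; field; lra.
by apply: Rmult_le_compat_r; lra.
Qed.

End Products.

(** * Elementary estimates *)

Section PowerEstimates.
Variables (L delta : R).
Hypothesis L0 : 0 <= L.
Hypothesis delta0 : 0 < delta.

(** Convexity of the power: the tangent at [L] stays below the secant.  The whole
    section trades powers of [k] for an increase of the radius from [L] to
    [L + delta]. *)
Lemma pow_derive_le k : INR k * L ^ k.-1 * delta <= (L + delta) ^ k - L ^ k.
Proof.
elim: k => [|k IH]; first by rewrite /=; lra.
have a0 := pow_le L k L0.
have e : INR k.+1 * L ^ k.+1.-1 * delta = L * (INR k * L ^ k.-1 * delta) + L ^ k * delta.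
  rewrite S_INR /=; case: k {IH a0} => [|k] /=; ring.
have b0 : 0 <= INR k * L ^ k.-1 * delta.
  apply: Rmult_le_pos; last by lra.
  by apply: Rmult_le_pos (pos_INR _) (pow_le _ _ L0).
rewrite e -!tech_pow_Rmult; nra.
Qed.

(** As for the derivative, the divided differences of [t ^ k] on [[- L, L]] are
    dominated by the one of [L ^ k] with step [delta]. *)
Lemma pow_lipschitz k s t : Rabs s <= L -> Rabs t <= L ->
  Rabs (t ^ k - s ^ k) * delta <= Rabs (t - s) * ((L + delta) ^ k - L ^ k).
Proof.
move=> sL tL; elim: k => [|k IH].
  by rewrite /= !Rminus_diag Rabs_R0; lra.
have a0 := Rabs_pos (t ^ k - s ^ k); have d0 := Rabs_pos (t - s).
have sk : Rabs (s ^ k) <= L ^ k by rewrite -RPow_abs; apply: pow_incr; split=> //; apply: Rabs_pos.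
have sk0 := Rabs_pos (s ^ k); have t0 := Rabs_pos t.
have -> : t ^ k.+1 - s ^ k.+1 = t * (t ^ k - s ^ k) + (t - s) * s ^ k by rewrite /=; ring.
have q := Rabs_triang (t * (t ^ k - s ^ k)) ((t - s) * s ^ k).
rewrite !Rabs_mult in q.
have q1 : Rabs t * Rabs (t ^ k - s ^ k) <= L * Rabs (t ^ k - s ^ k) by apply: Rmult_le_compat_r.
have q2 : Rabs (t - s) * Rabs (s ^ k) <= Rabs (t - s) * L ^ k by apply: Rmult_le_compat_l.
apply: Rle_trans (_ : (L * Rabs (t ^ k - s ^ k) + Rabs (t - s) * L ^ k) * delta <= _).
  by apply: Rmult_le_compat_r; lra.
have p0 : 0 <= (L + delta) ^ k - L ^ k.
  have := pow_derive_le k; have := pos_INR k; have := pow_le L k.-1 L0 => u1 u2 u3.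
  by apply: Rle_trans u3; apply: Rmult_le_pos; [apply: Rmult_le_pos | lra].
have := Rmult_le_compat_l L _ _ L0 IH.
have := Rmult_le_pos _ _ d0 p0.
rewrite -!tech_pow_Rmult; nra.
Qed.

(** The second-order Taylor remainder of a power of [t] is controlled by the one
    of [L]: both obey the same recursion in the exponent. *)
Lemma pow_taylor k s t : Rabs s <= L -> Rabs t <= L ->
  Rabs (t ^ k - s ^ k - (t - s) * (INR k * s ^ k.-1)) * delta ^ 2 <=
  (t - s) ^ 2 * ((L + delta) ^ k - L ^ k - delta * (INR k * L ^ k.-1)).
Proof.
move=> sL tL; elim: k => [|k IH].
  rewrite /= (_ : 1 - 1 - _ = 0); last by ring.
  by rewrite Rabs_R0; apply: Req_le; ring.
set Q := (_ - delta * (INR k * _)) in IH.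
have s0 := Rabs_pos s; have t0 := Rabs_pos t.
have next u v : u ^ k.+1 - v ^ k.+1 - (u - v) * (INR k.+1 * v ^ k.+1.-1) =
   u * (u ^ k - v ^ k - (u - v) * (INR k * v ^ k.-1)) + (u - v) ^ 2 * (INR k * v ^ k.-1).
  rewrite S_INR /=; case: (k) => [|j]; rewrite ?S_INR /=; ring.
have -> : (L + delta) ^ k.+1 - L ^ k.+1 - delta * (INR k.+1 * L ^ k.+1.-1) =
  (L + delta) * Q + delta ^ 2 * (INR k * L ^ k.-1).
  by have := next (L + delta) L; rewrite (_ : L + delta - L = delta) //; ring.
rewrite next; set E := (_ - _ - _) in IH *.
set v := INR k * s ^ k.-1; set w := INR k * L ^ k.-1.
have vw : Rabs v <= w.
  rewrite Rabs_mult (Rabs_pos_eq _ (pos_INR k)); apply: Rmult_le_compat_l; first exact: pos_INR.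
  by rewrite -RPow_abs; apply: pow_incr; split=> //; apply: Rabs_pos.
have d2 : 0 < delta ^ 2 by apply: pow_lt.
have h2 : 0 <= (t - s) ^ 2 by apply: pow2_ge_0.
have E0 := Rabs_pos E.
have Qp : 0 <= (t - s) ^ 2 * Q by apply: Rle_trans IH; apply: Rmult_le_pos; lra.
have q := Rabs_triang (t * E) ((t - s) ^ 2 * v).
rewrite (Rabs_mult t) (Rabs_mult ((t - s) ^ 2)) (Rabs_pos_eq _ h2) in q.
have q1 : Rabs t * Rabs E <= L * Rabs E by apply: Rmult_le_compat_r.
have q2 : (t - s) ^ 2 * Rabs v <= (t - s) ^ 2 * w by apply: Rmult_le_compat_l.
apply: Rle_trans (_ : (L * Rabs E + (t - s) ^ 2 * w) * delta ^ 2 <= _).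
  by apply: Rmult_le_compat_r; lra.
have := Rmult_le_compat_l L _ _ L0 IH.
have := Rmult_le_pos _ _ (Rlt_le _ _ delta0) Qp.
by rewrite /w; nra.
Qed.

End PowerEstimates.

Lemma le_exp y : y <= exp y.
Proof. by have := exp_ineq1_le y; lra. Qed.

Lemma exp_mono a b : a <= b -> exp a <= exp b.
Proof. by case=> [/exp_increasing|->]; lra. Qed.

Lemma sqr_le_exp y : 0 <= y -> y ^ 2 <= 4 * exp y.
Proof.
move=> y0; have -> : y = y / 2 + y / 2 by field.
rewrite exp_plus; have := exp_ineq1_le (y / 2); nra.
Qed.

Lemma Rabs_sin_le y : Rabs (sin y) <= Rabs y.
Proof.
have [c [_ e]] := MVT_gen sin 0 y cos
  (fun x _ => is_derive_sin x) (fun x _ => derivable_continuous_pt _ _ (derivable_pt_sin x)).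
rewrite sin_0 !Rminus_0_r in e; rewrite e Rabs_mult.
have := COS_bound c; have := Rabs_pos y => y0 c1.
have : Rabs (cos c) <= 1 by apply: Rabs_le; lra.
nra.
Qed.

Lemma Rabs_cos_sub1_le_sqr y : Rabs (cos y - 1) <= Rabs y ^ 2.
Proof.
have [c [hc e]] := MVT_gen cos 0 y (fun x => - sin x)
  (fun x _ => is_derive_cos x) (fun x _ => derivable_continuous_pt _ _ (derivable_pt_cos x)).
rewrite cos_0 !Rminus_0_r in e; rewrite e Rabs_mult Rabs_Ropp.
have h := Rabs_sin_le c.
have : Rabs c <= Rabs y.
  by move: hc; rewrite /Rmin /Rmax; case: Rle_dec => _; rewrite /Rabs; do 2 case: Rcase_abs; lra.
have := Rabs_pos y; have := Rabs_pos (sin c); nra.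
Qed.

Lemma Rabs_cos_sub1_le y : Rabs (cos y - 1) <= Rabs y.
Proof.
have [c [hc e]] := MVT_gen cos 0 y (fun x => - sin x)
  (fun x _ => is_derive_cos x) (fun x _ => derivable_continuous_pt _ _ (derivable_pt_cos x)).
rewrite cos_0 !Rminus_0_r in e; rewrite e Rabs_mult Rabs_Ropp.
have : Rabs (sin c) <= 1 by have := SIN_bound c; move=> ?; apply: Rabs_le; lra.
have := Rabs_pos y; nra.
Qed.

Lemma Rabs_sin_sub_le_sqr y : Rabs (sin y - y) <= Rabs y ^ 2.
Proof.
have d x : is_derive (fun x => sin x - x) x (cos x - 1).
  by auto_derive => //; ring.
have [c [hc e]] := MVT_gen (fun x => sin x - x) 0 y (fun x => cos x - 1)
  (fun x _ => d x) (fun x _ => derivable_continuous_pt _ _ (ex_derive_Reals_0 _ _ (ex_intro _ _ (d x)))).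
rewrite sin_0 !Rminus_0_r in e; rewrite e Rabs_mult.
have h := Rabs_cos_sub1_le c.
have : Rabs c <= Rabs y.
  by move: hc; rewrite /Rmin /Rmax; case: Rle_dec => _; rewrite /Rabs; do 2 case: Rcase_abs; lra.
have := Rabs_pos y; have := Rabs_pos (cos c - 1); nra.
Qed.

Lemma cis_add a b : cis (a + b) = Cmult (cis a) (cis b).
Proof. by rewrite /cis cos_plus sin_plus /Cmult /=; congr (_, _); ring. Qed.

Lemma Cmod_cis a : Cmod (cis a) = 1.
Proof.
rewrite /Cmod /cis /= !Rmult_1_r.
by have := sin2_cos2 a; rewrite /Rsqr Rplus_comm => ->; rewrite sqrt_1.
Qed.

Lemma cis_lipschitz a b : Cmod (Cminus (cis b) (cis a)) <= 2 * Rabs (b - a).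
Proof.
have -> : b = a + (b - a) by ring.
rewrite cis_add (_ : a + (b - a) - a = b - a); last by ring.
have -> : Cminus (Cmult (cis a) (cis (b - a))) (cis a) =
   Cmult (cis a) (Cminus (cis (b - a)) (RtoC 1)) by ring.
rewrite Cmod_mult Cmod_cis Rmult_1_l.
apply: Rle_trans (proj2 (proj2 (Cmod_components _))) _ => /=.
have := Rabs_cos_sub1_le (b - a); have := Rabs_sin_le (b - a).
rewrite /Rminus Ropp_0 Rplus_0_r; lra.
Qed.

Lemma cis_taylor a b :
  Cmod (Cminus (Cminus (cis b) (cis a)) (Cmult (RtoC (b - a)) (Cmult Ci (cis a))))
  <= 2 * (b - a) ^ 2.
Proof.
have -> : b = a + (b - a) by ring.
rewrite cis_add (_ : a + (b - a) - a = b - a); last by ring.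
have -> : Cminus (Cminus (Cmult (cis a) (cis (b - a))) (cis a))
     (Cmult (RtoC (b - a)) (Cmult Ci (cis a))) =
   Cmult (cis a) (Cminus (cis (b - a)) (Cplus (RtoC 1) (Cmult (RtoC (b - a)) Ci))) by ring.
rewrite Cmod_mult Cmod_cis Rmult_1_l.
apply: Rle_trans (proj2 (proj2 (Cmod_components _))) _ => /=.
have := Rabs_cos_sub1_le_sqr (b - a); have := Rabs_sin_sub_le_sqr (b - a).
have -> : Rabs (b - a) ^ 2 = (b - a) ^ 2 by rewrite pow2_abs.
move: (b - a) => h.
have -> : cos h + - (1 + (h * 0 - 0 * 1)) = cos h - 1 by ring.
have -> : sin h + - (0 + (h * 1 + 0 * 0)) = sin h - h by ring.
rewrite /=; lra.
Qed.

(** * Formal series in time and quasi-periodic exponentials *)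

(** Index set of the monomials [t^k * exp(i <n,omega> x)]. *)
Definition mono (nu : nat) : Type := (nat * {ffun 'I_nu -> Z})%type.
HB.instance Definition _ nu := Choice.on (mono nu).

Section Monomials.
Variable nu : nat.
Implicit Types (n m : {ffun 'I_nu -> Z}) (s : mono nu) (omega : 'I_nu -> R).

Definition zadd n m : {ffun 'I_nu -> Z} := [ffun j => (n j + m j)%Z].
Definition madd (p : mono nu * mono nu) : mono nu :=
  ((p.1.1 + p.2.1)%N, zadd p.1.2 p.2.2).

Lemma rsum_le_ord (f g : 'I_nu -> R) : (forall j, f j <= g j) ->
  \big[Rplus/0]_(j < nu) f j <= \big[Rplus/0]_(j < nu) g j.
Proof. by move=> h; apply: (big_ind2 Rle) => [||j _]; [lra|move=> *; lra|]. Qed.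

Lemma l1norm_ge0 n : 0 <= l1norm n.
Proof. by apply: (big_ind (fun x => 0 <= x)) => [||j _]; [lra|move=> *; lra|apply: Rabs_pos]. Qed.

Lemma l1norm_add n m : l1norm (zadd n m) <= l1norm n + l1norm m.
Proof.
rewrite /l1norm -big_split /=; apply: rsum_le_ord => j.
by rewrite ffunE plus_IZR; apply: Rabs_triang.
Qed.

Lemma pairing_add n m omega : pairing (zadd n m) omega = pairing n omega + pairing m omega.
Proof.
rewrite /pairing -big_split /=; apply: eq_bigr => j _.
by rewrite ffunE plus_IZR; ring.
Qed.

(** The constant in [|<n, omega>| <= C |n|] ([pairing_le]). *)
Definition freq_bound omega : R := \big[Rplus/0]_(j < nu) Rabs (omega j).

Lemma freq_bound_ge0 omega : 0 <= freq_bound omega.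
Proof. by apply: (big_ind (fun x => 0 <= x)) => [||j _]; [lra|move=> *; lra|apply: Rabs_pos]. Qed.

Lemma pairing_le n omega : Rabs (pairing n omega) <= freq_bound omega * l1norm n.
Proof.
have h j : Rabs (omega j) <= freq_bound omega.
  rewrite /freq_bound (bigD1 j) //= -[X in X <= _]Rplus_0_r; apply: Rplus_le_compat_l.
  by apply: (big_ind (fun x => 0 <= x)) => [||i _]; [lra|move=> *; lra|apply: Rabs_pos].
rewrite /pairing /l1norm.
apply: (big_ind2 (fun x y => Rabs x <= freq_bound omega * y)) => [|x1 y1 x2 y2 h1 h2|j _].
- by rewrite Rabs_R0; lra.
- by have := Rabs_triang x1 x2; lra.
- rewrite Rabs_mult Rmult_comm; apply: Rmult_le_compat_r => //; exact: Rabs_pos.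
Qed.

Definition weight (r kappa : R) s : R := r ^ s.1 * exp (kappa * l1norm s.2).

Lemma weight_gt0 r kappa s : 0 < r -> 0 < weight r kappa s.
Proof. by move=> r0; apply: Rmult_lt_0_compat (exp_pos _); apply: pow_lt. Qed.

(** Submultiplicativity of the weight is what makes the weighted l^1 space an algebra. *)
Lemma weight_madd r kappa p : 0 < r -> 0 <= kappa ->
  weight r kappa (madd p) <= weight r kappa p.1 * weight r kappa p.2.
Proof.
move=> r0 k0; rewrite /weight /= pow_add.
have h : exp (kappa * l1norm (zadd p.1.2 p.2.2)) <=
    exp (kappa * l1norm p.1.2) * exp (kappa * l1norm p.2.2).
  rewrite -exp_plus; apply: exp_mono.
  by have := l1norm_add p.1.2 p.2.2; nra.
have a := pow_lt r p.1.1 r0; have b := pow_lt r p.2.1 r0.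
apply: Rle_trans (Rmult_le_compat_l _ _ _ _ h) _; last by apply: Req_le; ring.
by apply: Rmult_le_pos; lra.
Qed.

Definition chi omega t x s : C := Cmult (RtoC (t ^ s.1)) (cis (pairing s.2 omega * x)).

(** The monomials are characters, so multiplying series amounts to convolving
    coefficients. *)
Lemma chi_madd omega t x p : chi omega t x (madd p) = Cmult (chi omega t x p.1) (chi omega t x p.2).
Proof.
rewrite /chi /= pow_add RtoC_mult pairing_add Rmult_plus_distr_r cis_add; ring.
Qed.

Lemma Cmod_chi_le omega t x s r kappa : Rabs t <= r -> 0 <= kappa ->
  Cmod (chi omega t x s) <= weight r kappa s.
Proof.
move=> tr k0; rewrite /chi Cmod_mult Cmod_cis Cmod_R Rmult_1_r /weight -RPow_abs.
have h : Rabs t ^ s.1 <= r ^ s.1 by apply: pow_incr; split=> //; apply: Rabs_pos.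
have h0 : 0 <= r ^ s.1 by apply: pow_le; have := Rabs_pos t; lra.
have : 1 <= exp (kappa * l1norm s.2).
  by have := exp_ineq1_le (kappa * l1norm s.2); have := l1norm_ge0 s.2; nra.
by nra.
Qed.

End Monomials.

Section WeightedSeries.
Variables (nu : nat) (omega : 'I_nu -> R).
Implicit Types (g h : mono nu -> C) (s : mono nu).

Definition wbound r kappa g (S : R) : Prop :=
  abs_bound (fun s => Cmult (RtoC (weight r kappa s)) (g s)) S.

Lemma wbound_dominates r kappa g S (f : mono nu -> C) c :
  0 < r -> 0 <= c -> wbound r kappa g S ->
  (forall s, Cmod (f s) <= c * weight r kappa s * Cmod (g s)) -> abs_bound f (c * S).
Proof.
move=> r0 c0 b h F; apply: Rle_trans (_ : c * rsum F (fun s => Cmod (Cmult (RtoC (weight r kappa s)) (g s))) <= _).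
  rewrite -rsum_scal; apply: rsum_le => s; apply: Rle_trans (h s) _.
  have w0 := weight_gt0 kappa s r0.
  by rewrite Cmod_mult Cmod_R Rabs_pos_eq; [apply: Req_le; ring|lra].
by apply: Rmult_le_compat_l (b F).
Qed.

Definition term g t x s : C := Cmult (g s) (chi omega t x s).
Definition qseries g t x : C := Sum (term g t x).

Lemma term_bound r kappa g S t x : 0 < r -> 0 <= kappa -> wbound r kappa g S -> Rabs t <= r ->
  abs_bound (term g t x) S.
Proof.
move=> r0 k0 b tr; rewrite -(Rmult_1_l S).
apply: (wbound_dominates r0 _ b); first by lra.
move=> s; rewrite Cmod_mult Rmult_1_l Rmult_comm.
by apply: Rmult_le_compat_r (Cmod_ge_0 _) (Cmod_chi_le _ _ _ _ _).
Qed.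

Lemma qseries_sum r kappa g S t x : 0 < r -> 0 <= kappa -> wbound r kappa g S -> Rabs t <= r ->
  is_sum (term g t x) (qseries g t x).
Proof. by move=> r0 k0 b tr; apply: Sum_correct (term_bound x r0 k0 b tr). Qed.

(** * Products *)

Definition tensor g h (p : mono nu * mono nu) : C := Cmult (g p.1) (h p.2).
(** Convolution on the monoid [mono nu], written as a sum over the fibre of the
    addition so that [is_sum_regroup] applies to it literally. *)
Definition conv g h s : C := Sum (fiber (@madd nu) (tensor g h) s).

Lemma tensor_wbound r kappa g h S1 S2 : 0 < r -> 0 <= kappa ->
  wbound r kappa g S1 -> wbound r kappa h S2 ->
  abs_bound (fun p => Cmult (RtoC (weight r kappa (madd p))) (tensor g h p)) (S1 * S2).
Proof.
move=> r0 k0 b1 b2; apply: abs_bound_le (abs_bound_prod b1 b2) => p.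
rewrite /tensor /= !Cmod_mult !Cmod_R.
have w1 := weight_gt0 kappa p.1 r0; have w2 := weight_gt0 kappa p.2 r0.
have w := weight_gt0 kappa (madd p) r0.
rewrite !Rabs_pos_eq; try by apply: Rlt_le.
have q := Rmult_le_pos _ _ (Cmod_ge_0 (g p.1)) (Cmod_ge_0 (h p.2)).
apply: Rle_trans (Rmult_le_compat_r _ _ _ q (weight_madd p r0 k0)) _; apply: Req_le.
have swap a b c d : a * b * (c * d) = a * c * (b * d) by ring.
exact: swap.
Qed.

(** Along a fibre the product weight is bounded below by the positive constant
    [weight r kappa s], so the weighted bound gives plain summability there. *)
Lemma conv_sum r kappa g h S1 S2 s : 0 < r -> 0 <= kappa ->
  wbound r kappa g S1 -> wbound r kappa h S2 ->
  is_sum (fiber (@madd nu) (tensor g h) s) (conv g h s).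
Proof.
move=> r0 k0 b1 b2.
have [v hv] := abs_bound_summable (abs_bound_fiber (@madd nu) s (tensor_wbound r0 k0 b1 b2)).
have w := weight_gt0 kappa s r0.
have w0 : RtoC (weight r kappa s) <> RtoC 0 by move/RtoC_inj; lra.
have hv2 := is_sum_scal (c := Cinv (RtoC (weight r kappa s))) hv.
have hv3 : is_sum (fiber (@madd nu) (tensor g h) s) (Cmult (Cinv (RtoC (weight r kappa s))) v).
  apply: is_sum_ext hv2 => i.
  rewrite /fiber; case: eqP => [->|_]; last by ring.
  by rewrite Cmult_assoc Cinv_l // Cmult_1_l.
by rewrite /conv (Sum_unique hv3).
Qed.

Lemma conv_wbound r kappa g h S1 S2 : 0 < r -> 0 <= kappa ->
  wbound r kappa g S1 -> wbound r kappa h S2 -> wbound r kappa (conv g h) (S1 * S2).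
Proof.
move=> r0 k0 b1 b2.
apply: (abs_bound_regroup (p := @madd nu) (tensor_wbound r0 k0 b1 b2)) => s.
have c := is_sum_scal (c := RtoC (weight r kappa s)) (conv_sum (s := s) r0 k0 b1 b2).
apply: is_sum_ext c => i.
rewrite /fiber; case: eqP => [->//|_]; ring.
Qed.

Lemma qseries_conv r kappa g h S1 S2 t x : 0 < r -> 0 <= kappa ->
  wbound r kappa g S1 -> wbound r kappa h S2 -> Rabs t <= r ->
  qseries (conv g h) t x = Cmult (qseries g t x) (qseries h t x).
Proof.
move=> r0 k0 b1 b2 tr; apply: Sum_unique.
have a1 := term_bound x r0 k0 b1 tr; have a2 := term_bound x r0 k0 b2 tr.
have p := is_sum_prod a1 a2 (qseries_sum (x := x) r0 k0 b1 tr) (qseries_sum (x := x) r0 k0 b2 tr).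
apply: (is_sum_regroup (abs_bound_prod a1 a2) p (p := @madd nu)) => s.
have c := is_sum_scal (c := chi omega t x s) (conv_sum (s := s) r0 k0 b1 b2).
rewrite /term Cmult_comm; apply: is_sum_ext c => i.
rewrite /fiber; case: eqP => [<-|_]; last by ring.
rewrite chi_madd.
have swap (a b c' d : C) : Cmult (Cmult a b) (Cmult c' d) = Cmult (Cmult c' a) (Cmult d b) by ring.
exact: swap.
Qed.

(** * Fourier coefficients *)

(** The coefficient of a single frequency: the sum over all powers of time. *)
Definition coef g t (n : {ffun 'I_nu -> Z}) : C :=
  Sum (fiber snd (fun s : mono nu => Cmult (RtoC (t ^ s.1)) (g s)) n).

Lemma coef_sum r kappa g S t n : 0 < r -> 0 <= kappa -> wbound r kappa g S -> Rabs t <= r ->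
  is_sum (fiber snd (fun s : mono nu => Cmult (RtoC (t ^ s.1)) (g s)) n) (coef g t n).
Proof.
move=> r0 k0 b tr; apply: (Sum_correct (S := S)); apply: abs_bound_fiber.
apply: abs_bound_le (term_bound 0 r0 k0 b tr) => s.
by rewrite /term /chi !Cmod_mult Cmod_cis; apply: Req_le; ring.
Qed.

Lemma qseries_expansion r kappa g S t x : 0 < r -> 0 <= kappa -> wbound r kappa g S -> Rabs t <= r ->
  is_qp_series omega (coef g t) x (qseries g t x).
Proof.
move=> r0 k0 b tr.
apply: (is_sum_regroup (term_bound x r0 k0 b tr) (qseries_sum (x := x) r0 k0 b tr) (p := snd)) => n.
have c := is_sum_scal (c := cis (pairing n omega * x)) (coef_sum (n := n) r0 k0 b tr).
rewrite Cmult_comm; apply: is_sum_ext c => i.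
rewrite /fiber; case: eqP => [<-|_]; last by ring.
have swap (u v w : C) : Cmult u (Cmult v w) = Cmult w (Cmult v u) by ring.
exact: swap.
Qed.

Lemma coef_decay r kappa g S t n : 0 < r -> 0 <= kappa -> wbound r kappa g S -> Rabs t <= r ->
  Cmod (coef g t n) <= S * exp (- kappa * l1norm n).
Proof.
move=> r0 k0 b tr.
pose e (n : {ffun 'I_nu -> Z}) := RtoC (exp (kappa * l1norm n)).
have b1 : abs_bound (fun s : mono nu => Cmult (e s.2) (Cmult (RtoC (t ^ s.1)) (g s))) S.
  apply: abs_bound_le b => s; rewrite !Cmod_mult !Cmod_R /weight.
  have e0 := exp_pos (kappa * l1norm s.2).
  have p0 : 0 <= r ^ s.1 by apply: pow_le; lra.
  rewrite (Rabs_pos_eq (exp _)); last by lra.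
  rewrite (Rabs_pos_eq (_ * _)); last by apply: Rmult_le_pos; lra.
  have h : Rabs (t ^ s.1) <= r ^ s.1.
    by rewrite -RPow_abs; apply: pow_incr; split=> //; apply: Rabs_pos.
  rewrite -Rmult_assoc; apply: Rmult_le_compat_r; first exact: Cmod_ge_0.
  by rewrite Rmult_comm; apply: Rmult_le_compat_r; lra.
have b2 : abs_bound (fun n => Cmult (e n) (coef g t n)) S.
  apply: (abs_bound_regroup (p := snd) b1) => m.
  apply: is_sum_ext (is_sum_scal (c := e m) (coef_sum (n := m) r0 k0 b tr)) => i.
  by rewrite /fiber; case: eqP => [->//|_]; ring.
have := abs_bound_term n b2; rewrite Cmod_mult Cmod_R.
have e0 := exp_pos (kappa * l1norm n); rewrite Rabs_pos_eq; last by lra.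
have -> : - kappa * l1norm n = - (kappa * l1norm n) by ring.
rewrite exp_Ropp => q; apply: (Rmult_le_reg_l _ _ _ e0); apply: Rle_trans q _.
by apply: Req_le; field; lra.
Qed.

Lemma coef_0 g n : coef g 0 n = g (0%N, n).
Proof.
apply: Sum_unique.
have := @is_sum_single _ (fiber snd (fun s : mono nu => Cmult (RtoC (0 ^ s.1)) (g s)) n) (0%N, n).
rewrite {3}/fiber /= eqxx Cmult_1_l; apply.
move=> [[|k] m] /= h; rewrite /fiber /=; case: eqP => // e.
  by rewrite e eqxx in h.
by rewrite Rmult_0_l; ring.
Qed.

(** * Differentiation *)

(** The coefficients of the time derivative are shifted, since [t ^ k.+1] contributes
    to [t ^ k]. *)
Definition dt g s : C := Cmult (RtoC (INR s.1.+1)) (g (s.1.+1, s.2)).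
Definition dx g s : C := Cmult (Cmult Ci (RtoC (pairing s.2 omega))) (g s).

(** Shrinking the radius absorbs the factor [k] produced by a time derivative. *)
Lemma dt_wbound r r' kappa g S : 0 < r' < r -> wbound r kappa g S ->
  wbound r' kappa (dt g) (/ (r - r') * S).
Proof.
move=> hr b.
pose shift (s : mono nu) : mono nu := (s.1.+1, s.2).
have inj : injective shift by move=> [k n] [l m] [-> ->].
have b1 : abs_bound (fun s => Cmult (RtoC (weight r kappa (shift s))) (g (shift s))) S.
  move=> F; apply: Rle_trans (b [fset shift s | s in F]%fset).
  by rewrite big_imfset /=; [lra | move=> s1 s2 _ _ /inj].
move=> F; apply: Rle_trans (_ : / (r - r') * rsum F (fun s => Cmod (Cmult (RtoC (weight r kappa (shift s))) (g (shift s)))) <= _); last first.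
  by apply: Rmult_le_compat_l (b1 F); apply/Rlt_le/Rinv_0_lt_compat; lra.
rewrite -rsum_scal; apply: rsum_le => -[k n].
rewrite /dt /shift /weight !Cmod_mult !Cmod_R (Rabs_pos_eq (INR _)); last exact: pos_INR.
cbn [fst snd].
have r0 : 0 < r' by lra.
have d0 : 0 < r - r' by lra.
have e0 := exp_pos (kappa * l1norm n).
have p1 := pow_lt r' k r0; have p2 := pow_lt r k.+1 (Rlt_trans _ _ _ r0 (proj2 hr)).
rewrite !Rabs_pos_eq; try by apply: Rmult_le_pos; lra.
rewrite -!Rmult_assoc; apply: Rmult_le_compat_r; first exact: Cmod_ge_0.
have := pow_derive_le (Rlt_le _ _ r0) d0 k.+1.
rewrite (_ : r' + (r - r') = r); last by ring.
have p0 := pow_lt r' k.+1 r0.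
move=> q; apply: (Rmult_le_reg_l _ _ _ d0).
rewrite -!Rmult_assoc Rinv_r ?Rmult_1_l; last by lra.
have -> : (r - r') * r' ^ k * exp (kappa * l1norm n) * INR k.+1 =
  (INR k.+1 * r' ^ k.+1.-1 * (r - r')) * exp (kappa * l1norm n) by rewrite /=; ring.
apply: Rmult_le_compat_r; [exact: Rlt_le|apply: Rle_trans q _].
by change (r ^ k.+1 - r' ^ k.+1 <= r ^ k.+1); lra.
Qed.

Lemma freq_absorb kappa n : 0 < kappa ->
  Rabs (pairing n omega) <= freq_bound omega * (2 / kappa) * exp (kappa / 2 * l1norm n).
Proof.
move=> k0; apply: Rle_trans (pairing_le n omega) _.
rewrite Rmult_assoc; apply: Rmult_le_compat_l; first exact: freq_bound_ge0.
have := le_exp (kappa / 2 * l1norm n) => h.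
have -> : l1norm n = 2 / kappa * (kappa / 2 * l1norm n) by field; lra.
apply: Rmult_le_compat_l; first by apply/Rlt_le/Rdiv_lt_0_compat; lra.
by rewrite {1}(_ : kappa / 2 * _ = kappa / 2 * l1norm n) //; field; lra.
Qed.

(** Halving the exponential rate absorbs the frequency produced by a space derivative. *)
Lemma dx_wbound r kappa g S : 0 < r -> 0 < kappa -> wbound r kappa g S ->
  wbound r (kappa / 2) (dx g) (freq_bound omega * (2 / kappa) * S).
Proof.
move=> r0 k0 b.
have c0 : 0 <= freq_bound omega * (2 / kappa).
  by apply: Rmult_le_pos (freq_bound_ge0 _) _; apply/Rlt_le/Rdiv_lt_0_compat; lra.
apply: (wbound_dominates r0 c0 b) => s.
rewrite /dx !Cmod_mult Cmod_Ci !Cmod_R Rmult_1_l Rabs_pos_eq; last by apply/Rlt_le/weight_gt0.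
rewrite -Rmult_assoc; apply: Rmult_le_compat_r; first exact: Cmod_ge_0.
have e0 := exp_pos (kappa / 2 * l1norm s.2).
have -> : weight r kappa s = weight r (kappa / 2) s * exp (kappa / 2 * l1norm s.2).
  rewrite /weight Rmult_assoc -exp_plus; congr (_ * exp _); field.
have := freq_absorb s.2 k0; have := weight_gt0 (kappa / 2) s r0; nra.
Qed.

End WeightedSeries.

(** * From quadratic remainders to derivatives *)

Lemma norm_Cmod (z : C) : @norm _ C_R_NormedModule z = Cmod z.
Proof.
rewrite /norm /= /prod_norm /Cmod; congr sqrt.
by rewrite /norm /= /abs /= !Rmult_1_r -!Rabs_mult !Rabs_pos_eq //; apply: Rle_0_sqr.
Qed.

(** Filter differentiability asks for the expansion at every limit point of the
    filter; inside a domain containing [t] the only one is [t] itself. *)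
Lemma quadratic_filterdiff (D : R -> Prop) (f : R -> C) t l c : D t ->
  (forall s, D s -> Cmod (Cminus (Cminus (f s) (f t)) (Cmult (RtoC (s - t)) l)) <= c * (s - t) ^ 2) ->
  filterdiff (U := R_NormedModule) (V := C_R_NormedModule) f
    (within D (locally t)) (fun h => scal h l).
Proof.
move=> Dt h; split; first exact: is_linear_scal_l.
move=> x hx.
have -> : x = t.
  apply: Rminus_diag_uniq; apply: NNPP => ne.
  have p : 0 < Rabs (x - t) by apply: Rabs_pos_lt.
  have := hx _ (@locally_ball R_UniformSpace x (mkposreal _ p)).
  move=> /locally_singleton /(_ Dt).
  by change (Rabs (t - x) < Rabs (x - t) -> False); rewrite Rabs_minus_sym; lra.
move=> {x hx} e.
have c0 : 0 <= Rabs c by apply: Rabs_pos.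
have p : 0 < e / (Rabs c + 1) by apply: Rdiv_lt_0_compat; [apply: cond_pos | lra].
exists (mkposreal _ p) => s bs Ds.
rewrite norm_Cmod.
have -> : @minus C_R_NormedModule (@minus C_R_NormedModule (f s) (f t)) (@scal _ C_R_NormedModule (minus s t) l) =
   Cminus (Cminus (f s) (f t)) (Cmult (RtoC (s - t)) l).
  case: (f s) => a1 a2; case: (f t) => b1 b2; case: l {h} => l1 l2.
  rewrite /Cminus /Cplus /Copp /Cmult /RtoC /minus /plus /opp /scal /= /prod_plus /prod_opp /prod_scal /= /scal /= /mult /= /plus /opp /=.
  by congr (_, _); ring.
apply: Rle_trans (h s Ds) _.
change (Rabs (s - t) < e / (Rabs c + 1)) in bs.
change (c * (s - t) ^ 2 <= e * Rabs (s - t)).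
have d0 := Rabs_pos (s - t).
have -> : (s - t) ^ 2 = Rabs (s - t) * Rabs (s - t) by rewrite -(pow2_abs (s - t)); ring.
have c1 : c <= Rabs c by apply: Rle_abs.
have q : (Rabs c + 1) * Rabs (s - t) <= e.
  have -> : pos e = (Rabs c + 1) * (e / (Rabs c + 1)) by field; lra.
  by apply: Rmult_le_compat_l; [lra | apply: Rlt_le].
have : c * Rabs (s - t) <= e by nra.
by move=> q1; nra.
Qed.

Lemma quadratic_is_derive (f : R -> C) x l c :
  (forall y, Cmod (Cminus (Cminus (f y) (f x)) (Cmult (RtoC (y - x)) l)) <= c * (y - x) ^ 2) ->
  is_derive_x f x l.
Proof.
move=> h.
have [lin dom] := @quadratic_filterdiff (fun _ => True) f x l c I (fun y _ => h y).
split=> // y hy e.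
have hy' : is_filter_lim (within (fun _ => True) (locally x)) y.
  by move=> P /hy h1; rewrite /within; move: h1; apply: filter_imp => z.
by have := dom y hy' e; rewrite /within; apply: filter_imp => z; apply.
Qed.

(** * Termwise calculus *)

Section Analytic.
Variables (nu : nat) (omega : 'I_nu -> R) (L : R).
Hypothesis L0 : 0 <= L.
Implicit Types (g h : mono nu -> C).

(** Absolute convergence with room to spare: a radius beyond [L] pays for time
    derivatives, exponential decay pays for space derivatives. *)
Definition analytic g : Prop :=
  exists r kappa S, L < r /\ 0 < kappa /\ wbound r kappa g S.

Lemma strip_abs t r : L < r -> 0 <= t <= L -> Rabs t <= r.
Proof. by move=> rL tL; rewrite Rabs_pos_eq; lra. Qed.

Lemma analytic_qseries_sum g t x : analytic g -> 0 <= t <= L ->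
  is_sum (term omega g t x) (qseries omega g t x).
Proof.
move=> [r [k [S [rL [k0 b]]]]] tL.
by apply: (qseries_sum _ _ b); [lra | lra | apply: strip_abs tL].
Qed.

Lemma analytic_dt g : analytic g -> analytic (dt g).
Proof.
move=> [r [k [S [rL [k0 b]]]]].
exists ((L + r) / 2), k, (/ (r - (L + r) / 2) * S); split; first by lra.
by split=> //; apply: dt_wbound b; lra.
Qed.

Lemma analytic_dx g : analytic g -> analytic (dx omega g).
Proof.
move=> [r [k [S [rL [k0 b]]]]].
exists r, (k / 2), (freq_bound omega * (2 / k) * S); split=> //; split; first by lra.
by apply: dx_wbound b; lra.
Qed.

(** The second-order remainder of [exp(i q x)] is at most [2 q^2 (y - x)^2], and the
    exponential weight absorbs [q^2]. *)
Lemma qseries_derive_x g t x : analytic g -> 0 <= t <= L ->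
  is_derive_x (fun y => qseries omega g t y) x (qseries omega (dx omega g) t x).
Proof.
move=> ag tL; have [r [k [S [rL [k0 b]]]]] := ag.
have tr := strip_abs rL tL.
apply: (@quadratic_is_derive _ _ _ (2 * (freq_bound omega ^ 2 * (4 / k ^ 2)) * S)) => y.
have s1 := is_sum_plus (analytic_qseries_sum (x := y) ag tL)
  (is_sum_scal (c := Copp (RtoC 1)) (analytic_qseries_sum (x := x) ag tL)).
have s2 := is_sum_plus s1 (is_sum_scal (c := Copp (RtoC (y - x)))
  (analytic_qseries_sum (x := x) (analytic_dx ag) tL)).
have -> : Cminus (Cminus (qseries omega g t y) (qseries omega g t x))
     (Cmult (RtoC (y - x)) (qseries omega (dx omega g) t x)) =
   Cplus (Cplus (qseries omega g t y) (Cmult (Copp (RtoC 1)) (qseries omega g t x)))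
     (Cmult (Copp (RtoC (y - x))) (qseries omega (dx omega g) t x)) by ring.
rewrite (_ : _ * S * _ = 2 * (freq_bound omega ^ 2 * (4 / k ^ 2)) * (y - x) ^ 2 * S); last by ring.
have k2 : 0 < k ^ 2 by apply: pow_lt.
have h2 := pow2_ge_0 (y - x); have w2 := pow2_ge_0 (freq_bound omega).
have c0 : 0 <= freq_bound omega ^ 2 * (4 / k ^ 2).
  by apply: Rmult_le_pos w2 _; apply/Rlt_le/Rdiv_lt_0_compat; lra.
apply: (is_sum_bound s2); apply: (wbound_dominates _ _ b); [lra | nra |].
move=> [j n]; rewrite /term /dx /chi; cbn [fst snd].
set q := pairing n omega; set z := RtoC (t ^ j).
have -> : Cplus (Cplus (Cmult (g (j, n)) (Cmult z (cis (q * y))))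
     (Cmult (Copp (RtoC 1)) (Cmult (g (j, n)) (Cmult z (cis (q * x))))))
     (Cmult (Copp (RtoC (y - x))) (Cmult (Cmult (Cmult Ci (RtoC q)) (g (j, n))) (Cmult z (cis (q * x))))) =
   Cmult (Cmult (g (j, n)) z) (Cminus (Cminus (cis (q * y)) (cis (q * x)))
     (Cmult (RtoC (q * y - q * x)) (Cmult Ci (cis (q * x))))).
  by rewrite -Rmult_minus_distr_l RtoC_mult; ring.
rewrite !Cmod_mult.
have hT := cis_taylor (q * x) (q * y).
have hz : Cmod z <= r ^ j.
  rewrite /z Cmod_R -RPow_abs; apply: pow_incr; split=> //; exact: Rabs_pos.
have hq : q ^ 2 <= freq_bound omega ^ 2 * (4 / k ^ 2) * exp (k * l1norm n).
  have l0 := l1norm_ge0 n.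
  have a := sqr_le_exp (Rmult_le_pos _ _ (Rlt_le _ _ k0) l0).
  have p := pairing_le n omega; rewrite -/q in p.
  have f0 := freq_bound_ge0 omega.
  have q2 : q ^ 2 <= (freq_bound omega * l1norm n) ^ 2.
    by rewrite -(pow2_abs q); apply: pow_incr; split=> //; apply: Rabs_pos.
  apply: Rle_trans q2 _; rewrite Rpow_mult_distr Rmult_assoc.
  apply: Rmult_le_compat_l => //.
  have -> : l1norm n ^ 2 = (k * l1norm n) ^ 2 / k ^ 2 by field; lra.
  have -> : 4 / k ^ 2 * exp (k * l1norm n) = 4 * exp (k * l1norm n) / k ^ 2 by field; lra.
  by apply: Rmult_le_compat_r a; apply/Rlt_le/Rinv_0_lt_compat.
rewrite /weight; cbn [fst snd].
have g0 := Cmod_ge_0 (g (j, n)); have z0 := Cmod_ge_0 z.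
set T := Cmod (Cminus _ _) in hT *; have T0 : 0 <= T by apply: Cmod_ge_0.
have e : (q * y - q * x) ^ 2 = q ^ 2 * (y - x) ^ 2 by ring.
rewrite e in hT.
set K := freq_bound omega ^ 2 * (4 / k ^ 2) in c0 hq *.
have hT2 : T <= 2 * (K * exp (k * l1norm n)) * (y - x) ^ 2.
  apply: Rle_trans hT _.
  have := Rmult_le_compat_r _ _ _ h2 hq; lra.
have hzT : Cmod z * T <= r ^ j * (2 * (K * exp (k * l1norm n)) * (y - x) ^ 2).
  exact: Rmult_le_compat.
have := Rmult_le_compat_l _ _ _ g0 hzT.
by move=> H; apply: Rle_trans (_ : Cmod (g (j, n)) * (Cmod z * T) <= _); [apply: Req_le; ring | apply: Rle_trans H _; apply: Req_le; ring].
Qed.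

(** Differentiating [t ^ k] lowers the exponent: the termwise derivative, regrouped
    by the new exponent, is the series of [dt g]. *)
Lemma dt_term_sum g t x : analytic g -> 0 <= t <= L ->
  is_sum (fun s : mono nu => Cmult (g s) (Cmult (RtoC (INR s.1 * t ^ s.1.-1)) (cis (pairing s.2 omega * x))))
    (qseries omega (dt g) t x).
Proof.
move=> ag tL; have [r [k [S [rL [k0 b]]]]] := ag.
pose G (s : mono nu) := Cmult (g s) (Cmult (RtoC (INR s.1 * t ^ s.1.-1)) (cis (pairing s.2 omega * x))).
have d0 : 0 < r - L by lra.
have r0 : 0 < r by lra.
have bG : abs_bound G (/ (r - L) * S).
  apply: (wbound_dominates r0 _ b); first by apply/Rlt_le/Rinv_0_lt_compat.
  move=> [j n]; rewrite /G !Cmod_mult Cmod_cis Cmod_R Rmult_1_r /weight; cbn [fst snd].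
  have t0 : 0 <= t ^ j.-1 by apply: pow_le; lra.
  have tl : t ^ j.-1 <= L ^ j.-1 by apply: pow_incr.
  have j0 := pos_INR j.
  rewrite Rabs_pos_eq; last by apply: Rmult_le_pos.
  have := pow_derive_le L0 d0 j; rewrite (_ : L + (r - L) = r); last by ring.
  have Lj := pow_le L j L0; have rj := pow_lt r j r0.
  move=> q.
  have e1 : 1 <= exp (k * l1norm n).
    by have := exp_ineq1_le (k * l1norm n); have := l1norm_ge0 n; nra.
  rewrite Rmult_comm; apply: Rmult_le_compat_r; first exact: Cmod_ge_0.
  apply: (Rmult_le_reg_l _ _ _ d0).
  have -> : (r - L) * (/ (r - L) * (r ^ j * exp (k * l1norm n))) = r ^ j * exp (k * l1norm n).
    by field; lra.
  have := Rmult_le_compat_l _ _ _ j0 tl; nra.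
have [v hv] := abs_bound_summable bG.
suff -> : qseries omega (dt g) t x = v by [].
apply: is_sum_unique (analytic_qseries_sum (x := x) (analytic_dt ag) tL) _.
apply: (is_sum_regroup (p := fun s : mono nu => (s.1.-1, s.2)) bG hv) => -[j n].
have := @is_sum_single _ (fiber (fun s : mono nu => (s.1.-1, s.2)) G (j, n)) (j.+1, n).
rewrite {3}/fiber eqxx /G /term /dt /chi; cbn [fst snd].
have -> : Cmult (g (j.+1, n)) (Cmult (RtoC (INR j.+1 * t ^ j.+1.-1)) (cis (pairing n omega * x))) =
   Cmult (Cmult (RtoC (INR j.+1)) (g (j.+1, n))) (Cmult (RtoC (t ^ j)) (cis (pairing n omega * x))).
  by rewrite [j.+1.-1]/= RtoC_mult; ring.
apply=> -[[|i] m] ne; rewrite /fiber; cbn [fst snd].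
  by case: eqP => // _; rewrite Rmult_0_l; ring.
case: eqP => //= -[ei em].
by rewrite ei em eqxx in ne.
Qed.


(** The remainders of the powers of [t] are summed by [pow_taylor], with the radius
    increased from [L] to [r]. *)
Lemma qseries_derive_t g t x : analytic g -> 0 <= t <= L ->
  is_derive_t L (fun s => qseries omega g s x) t (qseries omega (dt g) t x).
Proof.
move=> ag tL; have [r [k [S [rL [k0 b]]]]] := ag.
have d0 : 0 < r - L by lra.
have r0 : 0 < r by lra.
apply: (@quadratic_filterdiff _ _ _ _ (/ (r - L) ^ 2 * S)) => // s sL.
have s1 := is_sum_plus (analytic_qseries_sum (x := x) ag sL)
  (is_sum_scal (c := Copp (RtoC 1)) (analytic_qseries_sum (x := x) ag tL)).
have s2 := is_sum_plus s1 (is_sum_scal (c := Copp (RtoC (s - t))) (dt_term_sum (x := x) ag tL)).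
set u := qseries omega g s x in s2 *; set v := qseries omega g t x in s2 *.
set w := qseries omega (dt g) t x in s2 *.
have -> : Cminus (Cminus u v) (Cmult (RtoC (s - t)) w) =
   Cplus (Cplus u (Cmult (Copp (RtoC 1)) v)) (Cmult (Copp (RtoC (s - t))) w) by ring.
have -> : / (r - L) ^ 2 * S * (s - t) ^ 2 = / (r - L) ^ 2 * (s - t) ^ 2 * S by ring.
have d2 : 0 < (r - L) ^ 2 by apply: pow_lt.
have h2 := pow2_ge_0 (s - t).
apply: (is_sum_bound s2); apply: (wbound_dominates r0 _ b).
  by apply: Rmult_le_pos h2; apply/Rlt_le/Rinv_0_lt_compat.
move=> [j n]; rewrite /term /chi /weight; cbn [fst snd].
set e := cis _.
have -> : Cplus (Cplus (Cmult (g (j, n)) (Cmult (RtoC (s ^ j)) e))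
    (Cmult (Copp (RtoC 1)) (Cmult (g (j, n)) (Cmult (RtoC (t ^ j)) e))))
    (Cmult (Copp (RtoC (s - t))) (Cmult (g (j, n)) (Cmult (RtoC (INR j * t ^ j.-1)) e))) =
  Cmult (Cmult (RtoC (s ^ j - t ^ j - (s - t) * (INR j * t ^ j.-1))) e) (g (j, n)).
  by rewrite !RtoC_minus [RtoC ((s - t) * _)]RtoC_mult RtoC_minus; ring.
rewrite !Cmod_mult Cmod_cis Cmod_R Rmult_1_r.
apply: Rmult_le_compat_r; first exact: Cmod_ge_0.
have := @pow_taylor L (r - L) L0 d0 j t s; rewrite (_ : L + (r - L) = r); last by ring.
set X := Rabs (s ^ j - _ - _).
rewrite !Rabs_pos_eq; try lra; move=> /(_ (proj2 tL) (proj2 sL)) q.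
have Lj := pow_le L j L0; have rj := pow_lt r j r0.
have p0 : 0 <= (r - L) * (INR j * L ^ j.-1).
  by apply: Rmult_le_pos; [lra | apply: Rmult_le_pos (pos_INR _) (pow_le _ _ L0)].
have e1 : 1 <= exp (k * l1norm n).
  by have := exp_ineq1_le (k * l1norm n); have := l1norm_ge0 n; nra.
apply: (Rmult_le_reg_l _ _ _ d2).
have -> : (r - L) ^ 2 * (/ (r - L) ^ 2 * (s - t) ^ 2 * (r ^ j * exp (k * l1norm n))) =
   (s - t) ^ 2 * (r ^ j * exp (k * l1norm n)) by field; lra.
rewrite Rmult_comm; apply: Rle_trans q _; apply: Rmult_le_compat_l => //; nra.
Qed.

(** The series is Lipschitz on the strip, by the same absorption of [k] and of the
    frequency into the weight. *)
Lemma qseries_continuous g : analytic g -> continuous_strip L (qseries omega g).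
Proof.
move=> ag; have [r [k [S [rL [k0 b]]]]] := ag.
have d0 : 0 < r - L by lra.
have r0 : 0 < r by lra.
have S0 : 0 <= S := abs_bound_ge0 b.
pose A := / (r - L); pose B := 2 * (freq_bound omega * (2 / k)).
have A0 : 0 < A by apply: Rinv_0_lt_compat.
have B0 : 0 <= B.
  apply: Rmult_le_pos; first by lra.
  by apply: Rmult_le_pos (freq_bound_ge0 _) _; apply/Rlt_le/Rdiv_lt_0_compat; lra.
have lip t x s y : 0 <= t <= L -> 0 <= s <= L ->
  Cmod (Cminus (qseries omega g s y) (qseries omega g t x)) <=
  (A * Rabs (s - t) + B * Rabs (y - x)) * S.
  move=> tL sL.
  have s1 := is_sum_plus (analytic_qseries_sum (x := y) ag sL)
    (is_sum_scal (c := Copp (RtoC 1)) (analytic_qseries_sum (x := x) ag tL)).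
  set u := qseries omega g s y in s1 *; set v := qseries omega g t x in s1 *.
  have -> : Cminus u v = Cplus u (Cmult (Copp (RtoC 1)) v) by ring.
  have a0 := Rabs_pos (s - t); have b0 := Rabs_pos (y - x).
  apply: (is_sum_bound s1); apply: (wbound_dominates r0 _ b); first by nra.
  move=> [j n]; rewrite /term /chi /weight; cbn [fst snd].
  set q := pairing n omega.
  have -> : Cplus (Cmult (g (j, n)) (Cmult (RtoC (s ^ j)) (cis (q * y))))
     (Cmult (Copp (RtoC 1)) (Cmult (g (j, n)) (Cmult (RtoC (t ^ j)) (cis (q * x))))) =
    Cmult (Cplus (Cmult (RtoC (s ^ j - t ^ j)) (cis (q * y)))
       (Cmult (RtoC (t ^ j)) (Cminus (cis (q * y)) (cis (q * x))))) (g (j, n)).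
    by rewrite RtoC_minus; ring.
  rewrite Cmod_mult; apply: Rmult_le_compat_r; first exact: Cmod_ge_0.
  apply: Rle_trans (Cmod_triangle _ _) _; rewrite !Cmod_mult Cmod_cis !Cmod_R Rmult_1_r.
  have Lj := pow_le L j L0; have rj := pow_lt r j r0.
  have e0 := exp_pos (k / 2 * l1norm n).
  have e2 : 1 <= exp (k * l1norm n).
    by have := exp_ineq1_le (k * l1norm n); have := l1norm_ge0 n; nra.
  have e3 : exp (k / 2 * l1norm n) <= exp (k * l1norm n).
    by apply: exp_mono; have := l1norm_ge0 n; nra.
  have h1 : Rabs (s ^ j - t ^ j) <= A * Rabs (s - t) * (r ^ j * exp (k * l1norm n)).
    have := @pow_lipschitz L (r - L) L0 d0 j t s; rewrite (_ : L + (r - L) = r); last by ring.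
    rewrite (Rabs_pos_eq t) ?(Rabs_pos_eq s); try lra; move=> /(_ (proj2 tL) (proj2 sL)) p.
    apply: (Rmult_le_reg_r _ _ _ d0); apply: Rle_trans p _.
    have -> : A * Rabs (s - t) * (r ^ j * exp (k * l1norm n)) * (r - L) =
       Rabs (s - t) * (r ^ j * exp (k * l1norm n)) by rewrite /A; field; lra.
    by apply: Rmult_le_compat_l => //; nra.
  have h2 : Rabs (t ^ j) * Cmod (Cminus (cis (q * y)) (cis (q * x))) <=
     B * Rabs (y - x) * (r ^ j * exp (k * l1norm n)).
    have h3 : Rabs (t ^ j) <= r ^ j.
      by rewrite -RPow_abs; apply: pow_incr; split; [apply: Rabs_pos | apply: strip_abs].
    have h4 := cis_lipschitz (q * x) (q * y).
    have h5 : Rabs q <= freq_bound omega * (2 / k) * exp (k / 2 * l1norm n) := freq_absorb omega n k0.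
    rewrite -Rmult_minus_distr_l Rabs_mult in h4.
    have h6 : Cmod (Cminus (cis (q * y)) (cis (q * x))) <= B * Rabs (y - x) * exp (k * l1norm n).
      apply: Rle_trans h4 _.
      have h7 : Rabs q * Rabs (y - x) <= freq_bound omega * (2 / k) * exp (k / 2 * l1norm n) * Rabs (y - x).
        exact: Rmult_le_compat_r.
      have h8 : B * Rabs (y - x) * exp (k / 2 * l1norm n) <= B * Rabs (y - x) * exp (k * l1norm n).
        by apply: Rmult_le_compat_l e3; apply: Rmult_le_pos.
      by rewrite /B in h8 *; lra.
    apply: Rle_trans (Rmult_le_compat _ _ _ _ (Rabs_pos _) (Cmod_ge_0 _) h3 h6) _.
    by apply: Req_le; ring.
  lra.
move=> [t x] /= tL P [e he].
pose K := (A + B) * S + 1.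
have K0 : 0 < K by rewrite /K; nra.
have p : 0 < e / K by apply: Rdiv_lt_0_compat => //; apply: cond_pos.
exists (mkposreal _ p) => -[s y] [/= bs by'] sL; apply: he.
move: bs by'; rewrite /ball /= /AbsRing_ball /abs /minus /plus /opp /= => bs by'.
have l1 := lip t x s y tL sL.
have c : Cmod (Cminus (qseries omega g s y) (qseries omega g t x)) < e.
  have : (A * Rabs (s - t) + B * Rabs (y - x)) * S <= ((A + B) * S) * (e / K).
    rewrite (_ : (A + B) * S * (e / K) = (A * (e / K) + B * (e / K)) * S); last by ring.
    apply: Rmult_le_compat_r => //; rewrite /Rminus; apply: Rplus_le_compat; apply: Rmult_le_compat_l; lra.
  have ee : pos e = (A + B) * S * (e / K) + e / K.
    by rewrite -[X in _ + X]Rmult_1_l -Rmult_plus_distr_r -/K; field; lra.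
  lra.
have [c1 [c2 _]] := Cmod_components (Cminus (qseries omega g s y) (qseries omega g t x)).
split; rewrite /ball /= /AbsRing_ball /abs /minus /plus /opp /=; move: c1 c2 => /=; lra.
Qed.

End Analytic.

(** * Summability of exponentially decaying coefficients *)

Lemma rsum_uniq_sub (T : eqType) (s t : seq T) (f : T -> R) :
  (forall i, 0 <= f i) -> uniq s -> {subset s <= t} -> rsum s f <= rsum t f.
Proof.
move=> f0; elim: s t => [|x s IH] t.
  by move=> _ _; rewrite big_nil; apply: (big_ind (fun y => 0 <= y)) => [||i _]; [lra|move=> *; lra|].
move=> /= /andP [xs us] st.
have xt : x \in t by apply: st; rewrite inE eqxx.
rewrite big_cons (perm_big _ (perm_to_rem xt)) big_cons; apply: Rplus_le_compat_l.
apply: IH => // y ys.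
have : y \in t by apply: st; rewrite inE ys orbT.
rewrite (perm_mem (perm_to_rem xt)) inE => /orP [/eqP e|//].
by rewrite -e ys in xs.
Qed.

Lemma geometric_two_sided q N : 0 <= q ->
  (1 - q) * \big[Rplus/0]_(i < N.*2.+1) q ^ Z.abs_nat (Z.of_nat i - Z.of_nat N) <= 1 + q.
Proof.
move=> q0; suff -> : (1 - q) * \big[Rplus/0]_(i < N.*2.+1) q ^ Z.abs_nat (Z.of_nat i - Z.of_nat N) =
    1 + q - 2 * q ^ N.+1 by have := pow_le q N.+1 q0; lra.
pose f N i := q ^ Z.abs_nat (Z.of_nat i - Z.of_nat N).
rewrite -/(f N) -(big_mkord xpredT (f N)).
elim: N => [|N IH]; first by rewrite big_nat1 /f /=; ring.
rewrite doubleS big_nat_recl // big_nat_recr //=.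
have -> : f N.+1 0%N = q ^ N.+1 by rewrite /f; congr (_ ^ _); lia.
have -> : f N.+1 N.*2.+2 = q ^ N.+1.
  by rewrite /f; congr (_ ^ _); lia.
have -> : \big[Rplus/0]_(0 <= i < N.*2.+1) f N.+1 i.+1 = \big[Rplus/0]_(0 <= i < N.*2.+1) f N i.
  by apply: eq_bigr => i _; rewrite /f; congr (_ ^ _); lia.
move: IH; set X := \big[Rplus/0]_(_ <= i < _) _ => IH.
have -> : (1 - q) * (q ^ N.+1 + (X + q ^ N.+1)) = (1 - q) * X + (1 - q) * 2 * q ^ N.+1 by ring.
by rewrite IH /=; ring.
Qed.

(** A finite set of frequencies lies in a box, over which the sum of the exponentials
    factors into [nu] one-dimensional sums. *)
Lemma exp_box_sum (kappa B : R) nu (F : {fset {ffun 'I_nu -> Z}}) :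
  (forall N, \big[Rplus/0]_(i < N.*2.+1) exp (- kappa * Rabs (IZR (Z.of_nat i - Z.of_nat N))) <= B) ->
  rsum F (fun n => exp (- kappa * l1norm n)) <= B ^ nu.
Proof.
move=> hB.
have [N hN] : exists N, forall n : {ffun 'I_nu -> Z}, n \in (F : seq _) -> forall j, (Z.abs (n j) <= Z.of_nat N)%Z.
  elim: (F : seq _) => [|m s [N IH]]; first by exists 0%N.
  exists (\max_(j < nu) Z.abs_nat (m j) + N)%N => n; rewrite inE => /orP [/eqP ->|/IH h] j.
    have : (Z.abs_nat (m j) <= \max_(j < nu) Z.abs_nat (m j))%N by apply: leq_bigmax.
    move/leP/Nat2Z.inj_le; rewrite Zabs2Nat.id_abs => hm; apply: Z.le_trans hm _.
    by apply/Nat2Z.inj_le/leP; apply: leq_addr.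
  apply: Z.le_trans (h j) _.
  by apply/Nat2Z.inj_le/leP; apply: leq_addl.
pose phi (f : {ffun 'I_nu -> 'I_(N.*2.+1)}) : {ffun 'I_nu -> Z} :=
  [ffun j => (Z.of_nat (f j) - Z.of_nat N)%Z].
apply: Rle_trans (_ : rsum (map phi (enum {ffun 'I_nu -> 'I_(N.*2.+1)})) (fun n => exp (- kappa * l1norm n)) <= _).
  apply: rsum_uniq_sub; [by move=> n; apply/Rlt_le/exp_pos | exact: fset_uniq |].
  move=> n nF; apply/mapP.
  have shift z : (Z.abs z <= Z.of_nat N)%Z ->
      (Z.to_nat (z + Z.of_nat N) < N.*2.+1)%N /\
      z = (Z.of_nat (Z.to_nat (z + Z.of_nat N)) - Z.of_nat N)%Z by move=> h; split; lia.
  have lt j : (Z.to_nat (n j + Z.of_nat N) < N.*2.+1)%N := proj1 (shift _ (hN n nF j)).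
  exists [ffun j => Ordinal (lt j)]; first by rewrite mem_enum.
  apply/ffunP => j; rewrite !ffunE; exact: (proj2 (shift _ (hN n nF j))).
rewrite big_map big_enum /=.
have -> : \big[Rplus/0]_(f : {ffun 'I_nu -> 'I_(N.*2.+1)}) exp (- kappa * l1norm (phi f)) =
  \big[Rplus/0]_(f : {ffun 'I_nu -> 'I_(N.*2.+1)})
     \big[Rmult/1]_(j < nu) exp (- kappa * Rabs (IZR (Z.of_nat (f j) - Z.of_nat N))).
  apply: eq_bigr => f _; rewrite /l1norm.
  apply: (big_ind2 (fun x y => exp (- kappa * x) = y)) => [|x1 y1 x2 y2 <- <-|j _].
  - by rewrite Rmult_0_r exp_0.
  - by rewrite Rmult_plus_distr_l exp_plus.
  - by rewrite ffunE.
rewrite -(bigA_distr_bigA (fun (_ : 'I_nu) (i : 'I_(N.*2.+1)) => exp (- kappa * Rabs (IZR (Z.of_nat i - Z.of_nat N))))) /=.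
rewrite big_const_ord; set S := \big[Rplus/0]_(i < _) _.
have S0 : 0 <= S.
  by apply: (big_ind (fun x => 0 <= x)) => [||i _]; [lra|move=> *; lra|apply/Rlt_le/exp_pos].
have SB : S <= B by apply: hB.
elim: nu {F hN phi} => [|k IH] /=; first lra.
have : 0 <= iter k (Rmult S) 1 by elim: k {IH} => [|k IH] /=; [lra | apply: Rmult_le_pos].
by move=> h; apply: Rmult_le_compat.
Qed.

(** One dimension contributes [(1 + q) / (1 - q)] with [q = exp(- rho/2)], which is at
    most [6 / rho] because [exp(rho/2) >= 1 + rho/2]. *)
Lemma exp_decay_sum rho nu (F : {fset {ffun 'I_nu -> Z}}) : 0 < rho <= 1 ->
  rsum F (fun n => exp (- (rho / 2) * l1norm n)) <= (6 * / rho) ^ nu.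
Proof.
move=> hrho; apply: exp_box_sum => N.
pose q := exp (- (rho / 2)).
have q0 : 0 < q by apply: exp_pos.
have -> : \big[Rplus/0]_(i < N.*2.+1) exp (- (rho / 2) * Rabs (IZR (Z.of_nat i - Z.of_nat N))) =
   \big[Rplus/0]_(i < N.*2.+1) q ^ Z.abs_nat (Z.of_nat i - Z.of_nat N).
  apply: eq_bigr => i _; rewrite -abs_IZR -Zabs2Nat.id_abs -INR_IZR_INZ /q.
  elim: (Z.abs_nat _) => [|k IH]; first by rewrite Rmult_0_r exp_0.
  by rewrite S_INR Rmult_plus_distr_l exp_plus IH Rmult_1_r /=; ring.
have := geometric_two_sided N (Rlt_le _ _ q0).
set X := \big[Rplus/0]_(i < _) _ => hX.
have e1 : q * exp (rho / 2) = 1 by rewrite -exp_plus Rplus_opp_l exp_0.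
have e2 := exp_ineq1_le (rho / 2).
have hq : q * (1 + rho / 2) <= 1 by rewrite -e1; apply: Rmult_le_compat_l; lra.
(* [exp (rho/2) >= 1 + rho/2 >= (6+rho)/(6-rho)] bounds the two-sided geometric
   series by [6/rho]. *)
have h6 : rho * (1 + q) <= 6 * (1 - q) by nra.
have q1 : 0 < 1 - q by nra.
apply: (Rmult_le_reg_l (1 - q)) => //; apply: Rle_trans hX _.
apply: (Rmult_le_reg_l rho); first by lra.
by have -> : rho * ((1 - q) * (6 * / rho)) = 6 * (1 - q) by field; lra.
Qed.

Section Extension.
Variables I J : choiceType.

(** A family supported on the image of an injection is the family of fibre sums of its
    pullback. *)
Lemma abs_bound_extend (h : J -> I) (p : I -> J) (f : I -> C) S :
  cancel h p -> (forall i, h (p i) != i -> f i = RtoC 0) ->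
  abs_bound (fun j => f (h j)) S -> abs_bound f S.
Proof.
move=> hp f0 b; apply: (abs_bound_regroup (p := h) b) => i.
have -> : f i = fiber h (fun j => f (h j)) i (p i).
  by rewrite /fiber; case: eqP => [->//|/eqP/f0 ->].
apply: is_sum_single => j; rewrite /fiber; case: (h j =P i) => // <-.
by rewrite hp eqxx.
Qed.

Lemma abs_bound_plus (f g : I -> C) S1 S2 :
  abs_bound f S1 -> abs_bound g S2 -> abs_bound (fun i => Cplus (f i) (g i)) (S1 + S2).
Proof.
move=> b1 b2 F.
apply: Rle_trans (_ : rsum F (fun i => Cmod (f i) + Cmod (g i)) <= _).
  by apply: rsum_le => i; apply: Cmod_triangle.
by rewrite big_split /=; apply: Rplus_le_compat.
Qed.

End Extension.

(** * The coefficients of the solution *)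

Section Coefficients.
Variables (nu : nat) (omega : 'I_nu -> R) (c d : {ffun 'I_nu -> Z} -> C).

Definition symbol (n : {ffun 'I_nu -> Z}) : R :=
  pairing n omega ^ 2 / (1 + pairing n omega ^ 2).

(** In Fourier variables the equation is [u'' = - symbol * (u + u * u)], with
    [0 <= symbol <= 1]; for Taylor coefficients in time it is this recursion. *)
Definition step (a : mono nu -> C) (s : mono nu) : C :=
  match s.1 with
  | 0%N => c s.2
  | 1%N => d s.2
  | k.+2 => Cmult (RtoC (- symbol s.2 / (INR k.+1 * INR k.+2)))
                  (Cplus (a (k, s.2)) (conv a a (k, s.2)))
  end.

Definition picard (K : nat) : mono nu -> C := iter K step (fun _ => RtoC 0).

(** The diagonal value is the limit of the iteration: [picard K] no longer changes at
    time index [k] once [K > k]. *)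
Definition sol_coef (s : mono nu) : C := picard s.1.+1 s.

(** Only factors of time index at most [k] contribute to a convolution at time index
    [k]; this triangularity makes the recursion solvable. *)
Lemma conv_local (a b : mono nu -> C) k n :
  (forall j m, (j <= k)%N -> a (j, m) = b (j, m)) -> conv a a (k, n) = conv b b (k, n).
Proof.
move=> h; congr Sum; apply: functional_extensionality => -[[j1 m1] [j2 m2]].
rewrite /fiber /tensor; case: eqP => // -[e _] /=.
by rewrite !h // -e ?leq_addr ?leq_addl.
Qed.

Lemma picard_succ K k n : (k < K)%N -> picard K.+1 (k, n) = picard K (k, n).
Proof.
elim: K k n => // K IH [|[|k]] n // kK.
change (step (picard K.+1) (k.+2, n) = step (picard K) (k.+2, n)).
have h j m : (j <= k)%N -> picard K.+1 (j, m) = picard K (j, m).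
  by move=> jk; apply: IH; apply: leq_ltn_trans jk (ltnW kK).
by rewrite /step; cbn [fst snd]; rewrite h // (conv_local (b := picard K)).
Qed.

Lemma picard_stable K k n : (k < K)%N -> picard K (k, n) = sol_coef (k, n).
Proof.
elim: K => // K IH; rewrite ltnS leq_eqVlt => /orP [/eqP -> //|kK].
by rewrite picard_succ ?IH.
Qed.

Lemma sol_coef_step s : sol_coef s = step sol_coef s.
Proof.
case: s => -[|[|k]] n //.
change (step (picard k.+2) (k.+2, n) = step sol_coef (k.+2, n)).
rewrite /step; cbn [fst snd]; rewrite picard_stable //.
by rewrite (conv_local (b := sol_coef)) // => j m jk; apply: picard_stable; apply: ltnW; rewrite ltnS.
Qed.

Lemma symbol_bound n : 0 <= symbol n <= 1.
Proof.
rewrite /symbol; have := pow2_ge_0 (pairing n omega); move: (_ ^ 2) => y y0.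
split; first by apply: Rmult_le_pos => //; apply/Rlt_le/Rinv_0_lt_compat; lra.
by apply: (Rmult_le_reg_r (1 + y)); [lra | rewrite /Rdiv Rmult_assoc Rinv_l; lra].
Qed.

Variables (rho A M : R).
Hypothesis rho01 : 0 < rho <= 1.
Hypothesis A0 : 0 < A.
Hypothesis M1 : 1 <= M.
Hypothesis AM : A * (6 * / rho) ^ nu <= M.
Hypothesis c_decay : forall n, Cmod (c n) <= A * exp (- rho * l1norm n).
Hypothesis d_decay : forall n, Cmod (d n) <= A * exp (- rho * l1norm n).

Let r := 2 / (5 * M).
Let kappa := rho / 2.

(** Half of the decay rate of the data is spent on the weight, the other half makes the
    sum finite. *)
Lemma data_bound (f : {ffun 'I_nu -> Z} -> C) :
  (forall n, Cmod (f n) <= A * exp (- rho * l1norm n)) ->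
  abs_bound (fun n => Cmult (RtoC (exp (kappa * l1norm n))) (f n)) M.
Proof.
move=> h F; apply: Rle_trans AM.
apply: Rle_trans (_ : A * rsum F (fun n => exp (- (rho / 2) * l1norm n)) <= _).
  rewrite -rsum_scal; apply: rsum_le => n.
  have e0 := exp_pos (kappa * l1norm n).
  rewrite Cmod_mult Cmod_R Rabs_pos_eq; last by lra.
  have -> : - (rho / 2) * l1norm n = kappa * l1norm n + - rho * l1norm n by rewrite /kappa; field.
  by rewrite exp_plus; have := Rmult_le_compat_l _ _ _ (Rlt_le _ _ e0) (h n); lra.
by apply: Rmult_le_compat_l (exp_decay_sum F rho01); lra.
Qed.

Lemma r_gt0 : 0 < r.
Proof. by apply: Rdiv_lt_0_compat; lra. Qed.

(** On the ball of radius [2M] the three contributions to [step a] add up to at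
    most [M + r M + r^2/2 (2M + 4M^2) <= 1.88 M]. *)
Lemma step_wbound a : wbound r kappa a (2 * M) -> wbound r kappa (step a) (2 * M).
Proof.
move=> ba; have r0 := r_gt0.
have k0 : 0 <= kappa by rewrite /kappa; lra.
pose W f (s : mono nu) := Cmult (RtoC (weight r kappa s)) (f s).
pose f0 (s : mono nu) := if s.1 is 0%N then W (step a) s else RtoC 0.
pose f1 (s : mono nu) := if s.1 is 1%N then W (step a) s else RtoC 0.
pose f2 (s : mono nu) := if s.1 is k.+2 then W (step a) s else RtoC 0.
have b0 : abs_bound f0 M.
  apply: (@abs_bound_extend _ _ (fun n => (0%N, n) : mono nu) snd) => [//|[[|k] n] //=|].
    by rewrite eqxx.
  apply: abs_bound_le (data_bound c_decay) => n.
  by rewrite /f0 /W /step /weight; cbn [fst snd]; rewrite pow_O Rmult_1_l; apply: Rle_refl.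
have b1 : abs_bound f1 (r * M).
  apply: (@abs_bound_extend _ _ (fun n => (1%N, n) : mono nu) snd) => [//|[[|[|k]] n] //=|].
    by rewrite eqxx.
  move=> F; apply: Rle_trans (Rmult_le_compat_l _ _ _ (Rlt_le _ _ r0) (data_bound d_decay F)).
  rewrite -rsum_scal; apply: rsum_le => n; apply: Req_le.
  rewrite /f1 /W /step /weight; cbn [fst snd].
  rewrite pow_1 RtoC_mult !Cmod_mult (Cmod_R r) Rabs_pos_eq; [ring | lra].
have b2 : abs_bound f2 (r ^ 2 / 2 * (2 * M + 2 * M * (2 * M))).
  apply: (@abs_bound_extend _ _ (fun s => (s.1.+2, s.2) : mono nu) (fun s => (s.1.-2, s.2))).
  - by move=> [k n].
  - by move=> [[|[|k]] n] //=; rewrite eqxx.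
  have ba2 : abs_bound (W (fun s => Cplus (a s) (conv a a s))) (2 * M + 2 * M * (2 * M)).
    apply: abs_bound_le (abs_bound_plus ba (conv_wbound r0 k0 ba ba)) => s.
    by apply: Req_le; congr Cmod; rewrite /W; ring.
  have rr : 0 <= r ^ 2 / 2 by have := pow2_ge_0 r; lra.
  move=> F; apply: Rle_trans (Rmult_le_compat_l _ _ _ rr (ba2 F)).
  rewrite -rsum_scal; apply: rsum_le => -[k n].
  rewrite /f2 /W /step /weight; cbn [fst snd].
  rewrite !Cmod_mult; set X := Cmod (Cplus _ _); have X0 : 0 <= X by apply: Cmod_ge_0.
  have w0 : 0 <= r ^ k * exp (kappa * l1norm n).
    by apply: Rmult_le_pos; [apply: pow_le; lra | apply/Rlt_le/exp_pos].
  have -> : r ^ k.+2 * exp (kappa * l1norm n) = r ^ 2 * (r ^ k * exp (kappa * l1norm n)) by rewrite /=; ring.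
  rewrite RtoC_mult Cmod_mult !Cmod_R.
  rewrite (Rabs_pos_eq _ w0) (Rabs_pos_eq _ (pow2_ge_0 r)).
  have hs : Rabs (- symbol n / (INR k.+1 * INR k.+2)) <= / 2.
    have [s0 s1] := symbol_bound n; rewrite !S_INR; have k1 := pos_INR k.
    have den : 2 <= (INR k + 1) * (INR k + 1 + 1) by nra.
    rewrite /Rdiv Rabs_mult Rabs_Ropp (Rabs_pos_eq _ s0) Rabs_pos_eq; last by apply/Rlt_le/Rinv_0_lt_compat; lra.
    have : / ((INR k + 1) * (INR k + 1 + 1)) <= / 2 by apply: Rinv_le_contravar; lra.
    have : 0 < / ((INR k + 1) * (INR k + 1 + 1)) by apply: Rinv_0_lt_compat; lra.
    by nra.
  have := Rmult_le_compat_r _ _ _ X0 hs.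
  have := Rmult_le_pos _ _ (pow2_ge_0 r) w0; move: (r ^ 2) => r2; move: (_ * exp _) => w.
  by move=> h1 h2; have := Rmult_le_compat_l _ _ _ h1 h2; lra.
have b := abs_bound_plus (abs_bound_plus b0 b1) b2.
have num : M + r * M + r ^ 2 / 2 * (2 * M + 2 * M * (2 * M)) <= 2 * M.
  have rM : r * M = 2 / 5 by rewrite /r; field; lra.
  have -> : r ^ 2 / 2 * (2 * M + 2 * M * (2 * M)) = r * (r * M) + 2 * (r * M) * (r * M) by field.
  by rewrite rM; have : r <= 2 / 5; [rewrite -rM; nra | lra].
move=> F; apply: Rle_trans num; apply: Rle_trans (b F); apply: rsum_le => -[k n].
apply: Req_le; congr Cmod; rewrite /f0 /f1 /f2 -/(W (step a) (k, n)); cbn [fst].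
by move: (W _ _) => z; case: k => [|[|k]]; ring.
Qed.

(** A finite partial sum only sees finitely many time indices, so it coincides with one
    of a single iterate. *)
Lemma sol_coef_wbound : wbound r kappa sol_coef (2 * M).
Proof.
have bp K : wbound r kappa (picard K) (2 * M).
  elim: K => [|K IH]; last exact: step_wbound.
  move=> F; rewrite big1; first by lra.
  by move=> s _; rewrite Cmult_0_r Cmod_0.
move=> F.
have [K hK] : exists K, forall s, s \in (F : seq _) -> (s.1 < K)%N.
  elim: (F : seq (mono nu)) => [|s l [K h]]; first by exists 0%N.
  exists (maxn s.1.+1 K) => t; rewrite inE leq_max => /orP [/eqP ->|/h ->]; first by rewrite leqnn.
  by rewrite orbT.
apply: Rle_trans (bp K F); apply: Req_le; apply: eq_big_seq => -[k n] /hK kK.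
by rewrite picard_stable.
Qed.

Lemma sol_coef_analytic : analytic (1 / (5 * M)) sol_coef.
Proof.
exists r, kappa, (2 * M); split; last by split; [rewrite /kappa; lra | exact: sol_coef_wbound].
have -> : r = 2 * (1 / (5 * M)) by rewrite /r; field; lra.
have : 0 < 1 / (5 * M) by apply: Rdiv_lt_0_compat; lra.
by move: (1 / (5 * M)) => y; lra.
Qed.

Lemma conv_analytic L (a : mono nu -> C) : 0 <= L -> analytic L a -> analytic L (conv a a).
Proof.
move=> L0 [r' [k [S [rL [k0 b]]]]]; exists r', k, (S * S); split=> //; split=> //.
by apply: (conv_wbound _ _ b b); lra.
Qed.

Lemma coefficient_equation s :
  Cminus (Cminus (Cminus (dt (dt sol_coef) s) (dx omega (dx omega sol_coef) s))
    (dt (dt (dx omega (dx omega sol_coef))) s))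
    (dx omega (dx omega (conv sol_coef sol_coef)) s) = RtoC 0.
Proof.
case: s => k n; rewrite /dt /dx; cbn [fst snd].
rewrite (sol_coef_step (k.+2, n)) /step; cbn [fst snd].
set a := sol_coef (k, n); set b := conv _ _ _; set q := pairing n omega.
have i1 : INR k.+1 <> 0 by apply: not_0_INR.
have i2 : INR k.+2 <> 0 by apply: not_0_INR.
set z := Cmult (RtoC (INR k.+1)) (Cmult (RtoC (INR k.+2)) (Cmult (RtoC _) _)).
have ez : z = Cmult (RtoC (- symbol n)) (Cplus a b).
  by rewrite /z !Cmult_assoc -!RtoC_mult; congr (Cmult (RtoC _) _); field; split.
have cc : Cmult Ci Ci = Copp (RtoC 1) by rewrite /Cmult /Copp /RtoC /=; congr (_, _); ring.
set y := Cmult (RtoC (INR k.+1)) _.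
have -> : y = Cmult (Cmult (Cmult Ci Ci) (Cmult (RtoC q) (RtoC q))) z by rewrite /y /z; ring.
have -> : Cmult (Cmult Ci (RtoC q)) (Cmult (Cmult Ci (RtoC q)) a) =
  Cmult (Cmult (Cmult Ci Ci) (Cmult (RtoC q) (RtoC q))) a by ring.
have -> : Cmult (Cmult Ci (RtoC q)) (Cmult (Cmult Ci (RtoC q)) b) =
  Cmult (Cmult (Cmult Ci Ci) (Cmult (RtoC q) (RtoC q))) b by ring.
rewrite cc ez -RtoC_mult.
have es : q * q = symbol n * (1 + q * q).
  by rewrite /symbol -/q; field; have := pow2_ge_0 q; lra.
have ec : Cminus (RtoC (q * q)) (Cmult (RtoC (symbol n)) (Cplus (RtoC 1) (RtoC (q * q)))) = RtoC 0.
  by rewrite -RtoC_plus -RtoC_mult -es; ring.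
rewrite RtoC_opp -[RHS](Cmult_0_l (Cplus a b)) -ec; ring.
Qed.

(** * Existence *)

Let L := 1 / (5 * M).

Lemma L_gt0 : 0 < L.
Proof. by apply: Rdiv_lt_0_compat; lra. Qed.

Lemma qseries_classical_solution :
  classical_solution omega c d L (qseries omega sol_coef).
Proof.
have L0 := Rlt_le _ _ L_gt0.
have aa : analytic L sol_coef := sol_coef_analytic.
have ax := analytic_dx omega L0 aa; have axx := analytic_dx omega L0 ax.
have at' := analytic_dt L0 aa; have att := analytic_dt L0 at'.
have axxt := analytic_dt L0 axx; have axxtt := analytic_dt L0 axxt.
have ac := conv_analytic L0 aa.
have acx := analytic_dx omega L0 ac; have acxx := analytic_dx omega L0 acx.
have sq t x : 0 <= t <= L ->
    qseries omega (conv sol_coef sol_coef) t x = Cmult (qseries omega sol_coef t x) (qseries omega sol_coef t x).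
  move=> tL; have [r' [k [S [rL [k0 b]]]]] := aa.
  by apply: (qseries_conv omega x _ _ b b); [lra | lra | apply: strip_abs tL].
have tz : 0 <= 0 <= L by lra.
have init g (f : {ffun 'I_nu -> Z} -> C) x : analytic L g -> (forall n, g (0%N, n) = f n) ->
    is_qp_series omega f x (qseries omega g 0 x).
  move=> [r' [k [S [rL [k0 b]]]]] h.
  have -> : f = coef g 0 by apply: functional_extensionality => n; rewrite coef_0 h.
  by apply: (qseries_expansion _ _ b); [lra | lra | rewrite Rabs_R0; lra].
exists (qseries omega (dt sol_coef)), (qseries omega (dt (dt sol_coef))),
  (qseries omega (dx omega sol_coef)), (qseries omega (dx omega (dx omega sol_coef))),
  (qseries omega (dt (dx omega (dx omega sol_coef)))),
  (qseries omega (dt (dt (dx omega (dx omega sol_coef))))),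
  (qseries omega (dx omega (conv sol_coef sol_coef))),
  (qseries omega (dx omega (dx omega (conv sol_coef sol_coef)))).
split; first by split=> t x; apply: qseries_derive_t.
split; first by split=> t x; apply: qseries_derive_x.
split; first by split=> t x; apply: qseries_derive_t.
split.
  split=> t x tL; last exact: (qseries_derive_x omega L0 x acx tL).
  by apply: is_derive_ext (qseries_derive_x omega L0 x ac tL) => y; rewrite sq.
split.
  by split; [|split; [|split; [|split]]]; apply: qseries_continuous.
split.
  move=> t x tL.
  have s1 := is_sum_plus (analytic_qseries_sum (omega := omega) (x := x) L0 att tL)
    (is_sum_scal (c := Copp (RtoC 1)) (analytic_qseries_sum (omega := omega) (x := x) L0 axx tL)).
  have s2 := is_sum_plus s1
    (is_sum_scal (c := Copp (RtoC 1)) (analytic_qseries_sum (omega := omega) (x := x) L0 axxtt tL)).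
  have s3 := is_sum_plus s2
    (is_sum_scal (c := Copp (RtoC 1)) (analytic_qseries_sum (omega := omega) (x := x) L0 acxx tL)).
  rewrite (_ : Cminus _ _ = Cplus (Cplus (Cplus (qseries omega (dt (dt sol_coef)) t x)
     (Cmult (Copp (RtoC 1)) (qseries omega (dx omega (dx omega sol_coef)) t x)))
     (Cmult (Copp (RtoC 1)) (qseries omega (dt (dt (dx omega (dx omega sol_coef)))) t x)))
     (Cmult (Copp (RtoC 1)) (qseries omega (dx omega (dx omega (conv sol_coef sol_coef))) t x))); last by ring.
  apply: is_sum_unique s3 _; apply: is_sum_ext (is_sum_0 _) => s.
  rewrite -(Cmult_0_l (chi omega t x s)) -(coefficient_equation s) /term; ring.
split=> x; first exact: init.
by apply: init => // n; rewrite /dt; cbn [fst snd]; rewrite Cmult_1_l.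
Qed.

Lemma sol_qp_expansion : qp_expansion omega L (qseries omega sol_coef) (coef sol_coef).
Proof.
move=> t x tL; have L0 := L_gt0.
have [r' [k [S [rL [k0 b]]]]] : analytic L sol_coef := sol_coef_analytic.
by apply: (qseries_expansion _ _ b); [lra | lra | apply: strip_abs tL].
Qed.

Lemma sol_decay : exp_decay L (2 * M) (rho / 2) (coef sol_coef).
Proof.
move=> t n tL; apply: (coef_decay omega n r_gt0 _ sol_coef_wbound); first by rewrite /kappa; lra.
have e : r = 2 * L by rewrite /r /L; field; lra.
by rewrite Rabs_pos_eq; lra.
Qed.

End Coefficients.

(** * Real calculus on a closed time interval *)

Section TimeInterval.
Variable L : R.
Hypothesis L0 : 0 < L.

(** Precomposing with this retraction turns functions of a closed time interval into
    functions on the whole line, to which two-sided notions apply. *)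
Definition clamp (t : R) : R := Rmax 0 (Rmin t L).

Lemma clamp_in t : 0 <= clamp t <= L.
Proof. by rewrite /clamp /Rmax /Rmin; do 2 case: Rle_dec; lra. Qed.

Lemma clamp_id t : 0 <= t <= L -> clamp t = t.
Proof. by rewrite /clamp /Rmax /Rmin; do 2 case: Rle_dec; lra. Qed.

Lemma clamp_lipschitz s t : Rabs (clamp s - clamp t) <= Rabs (s - t).
Proof.
have h u v : u <= v -> 0 <= clamp v - clamp u <= v - u.
  rewrite /clamp => uv; have m1 : Rmin u L <= Rmin v L <= Rmin u L + (v - u).
    by rewrite /Rmin; repeat case: Rle_dec => [?|/Rnot_le_lt ?]; lra.
  by rewrite /Rmax; repeat case: Rle_dec => [?|/Rnot_le_lt ?]; lra.
case: (Rle_or_lt s t) => st.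
  by have q := h _ _ st; rewrite (Rabs_minus_sym s) (Rabs_minus_sym (clamp s)) !Rabs_pos_eq; lra.
by have q := h _ _ (Rlt_le _ _ st); rewrite !Rabs_pos_eq; lra.
Qed.

(** Differentiability within [[0, L]], hence one-sided at the endpoints. *)
Definition deriv_in (f : R -> R) (t l : R) : Prop :=
  forall e, 0 < e -> exists d, 0 < d /\
  forall s, 0 <= s <= L -> Rabs (s - t) < d -> Rabs (f s - f t - (s - t) * l) <= e * Rabs (s - t).

Lemma deriv_in_minus f g t l m :
  deriv_in f t l -> deriv_in g t m -> deriv_in (fun s => f s - g s) t (l - m).
Proof.
move=> hf hg e e0; have e2 : 0 < e / 2 by lra.
have [d1 [d10 h1]] := hf _ e2; have [d2 [d20 h2]] := hg _ e2.
exists (Rmin d1 d2); split; first exact: Rmin_glb_lt.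
move=> s sL sd.
have := h1 s sL (Rlt_le_trans _ _ _ sd (Rmin_l _ _)).
have := h2 s sL (Rlt_le_trans _ _ _ sd (Rmin_r _ _)).
have -> : f s - g s - (f t - g t) - (s - t) * (l - m) =
  (f s - f t - (s - t) * l) - (g s - g t - (s - t) * m) by ring.
have := Rabs_triang (f s - f t - (s - t) * l) (- (g s - g t - (s - t) * m)).
rewrite Rabs_Ropp /Rminus; lra.
Qed.

Lemma deriv_in_lipschitz f t l : 0 <= t <= L -> deriv_in f t l ->
  exists d, 0 < d /\ forall s, 0 <= s <= L -> Rabs (s - t) < d ->
    Rabs (f s - f t) <= (Rabs l + 1) * Rabs (s - t).
Proof.
move=> tL /(_ 1 Rlt_0_1) [d [d0 h]]; exists d; split=> // s sL sd.
have q := h s sL sd; have -> : f s - f t = (f s - f t - (s - t) * l) + (s - t) * l by ring.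
have := Rabs_triang (f s - f t - (s - t) * l) ((s - t) * l).
by rewrite (Rabs_mult (s - t)); lra.
Qed.

Lemma clamp_continuous f t : 0 <= t <= L -> (exists l, deriv_in f t l) ->
  continuity_pt (fun s => f (clamp s)) t.
Proof.
move=> tL [l /(deriv_in_lipschitz tL) [d [d0 h]]] e e0.
have a0 := Rabs_pos l.
exists (Rmin d (e / (Rabs l + 2))); split.
  by apply: Rmin_glb_lt => //; apply: Rdiv_lt_0_compat; lra.
move=> s [_]; rewrite /= /R_dist => sd.
have sd1 := Rlt_le_trans _ _ _ sd (Rmin_l _ _); have sd2 := Rlt_le_trans _ _ _ sd (Rmin_r _ _).
have c := clamp_lipschitz s t; rewrite (clamp_id tL) in c *.
apply: Rle_lt_trans (h _ (clamp_in s) (Rle_lt_trans _ _ _ c sd1)) _.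
have c0 := Rabs_pos (clamp s - t).
apply: Rle_lt_trans (_ : (Rabs l + 2) * Rabs (s - t) < e); first by nra.
have -> : e = (Rabs l + 2) * (e / (Rabs l + 2)) by field; lra.
by apply: Rmult_lt_compat_l; lra.
Qed.

Lemma clamp_derive f t l : 0 < t < L -> deriv_in f t l -> is_derive (fun s => f (clamp s)) t l.
Proof.
move=> tL h; apply/is_derive_Reals => e e0.
have [d [d0 hd]] := h _ (Rdiv_lt_0_compat _ 2 e0 Rlt_0_2).
have m0 : 0 < Rmin d (Rmin t (L - t)) by do 2 (apply: Rmin_glb_lt; try lra).
exists (mkposreal _ m0) => k k0 /= kd.
have k1 := Rlt_le_trans _ _ _ kd (Rmin_l _ _); have k2 := Rlt_le_trans _ _ _ kd (Rmin_r _ _).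
have k3 := Rlt_le_trans _ _ _ k2 (Rmin_l _ _); have k4 := Rlt_le_trans _ _ _ k2 (Rmin_r _ _).
have kL : 0 <= t + k <= L by move: k3 k4; rewrite /Rabs; case: Rcase_abs; lra.
rewrite !clamp_id; try lra.
have := hd (t + k) kL; rewrite (_ : t + k - t = k); last by ring.
move=> /(_ k1) q.
have -> : (f (t + k) - f t) / k - l = (f (t + k) - f t - k * l) / k by field.
rewrite Rabs_div //; have kk := Rabs_pos_lt _ k0.
apply: (Rmult_lt_reg_r _ _ _ kk); rewrite /Rdiv Rmult_assoc Rinv_l; nra.
Qed.

(** The mean value theorem only needs derivatives in the open interval, where clamping
    is harmless, and continuity at the endpoints. *)
Lemma MVT_in f f' a b : 0 <= a -> a <= b -> b <= L ->
  (forall t, 0 <= t <= L -> deriv_in f t (f' t)) ->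
  exists c, a <= c <= b /\ f b - f a = f' c * (b - a).
Proof.
move=> a0 ab bL h.
have [||c [hc e]] := MVT_gen (fun s => f (clamp s)) a b f'.
- rewrite Rmin_left // Rmax_right // => x hx; apply: clamp_derive; first by lra.
  by apply: h; lra.
- rewrite Rmin_left // Rmax_right // => x hx; apply: clamp_continuous; first by lra.
  by exists (f' x); apply: h; lra.
move: hc; rewrite Rmin_left // Rmax_right // => hc.
by exists c; split=> //; rewrite -e !clamp_id; lra.
Qed.

Lemma eq_of_deriv_in f g l : (forall t, 0 <= t <= L -> deriv_in f t (l t)) ->
  (forall t, 0 <= t <= L -> deriv_in g t (l t)) -> f 0 = g 0 ->
  forall t, 0 <= t <= L -> f t = g t.
Proof.
move=> hf hg e t tL.
have [|||s sL|c [_]] := @MVT_in (fun s => f s - g s) (fun s => l s - l s) 0 t; try lra.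
by apply: deriv_in_minus; [apply: hf | apply: hg].
Qed.

Lemma deriv_in_is_derive f t l : is_derive f t l -> deriv_in f t l.
Proof.
move=> /is_derive_Reals h e e0; have [d hd] := h e e0.
exists d; split; first exact: cond_pos.
move=> s _ sd; case: (Req_dec (s - t) 0) => [z|k0].
  have -> : s = t by lra.
  by rewrite !Rminus_diag Rmult_0_l Rminus_diag Rabs_R0; lra.
have := hd _ k0 sd; rewrite (_ : t + (s - t) = s); last by ring.
move=> q; have kk := Rabs_pos_lt _ k0.
have -> : f s - f t - (s - t) * l = ((f s - f t) / (s - t) - l) * (s - t) by field.
by rewrite Rabs_mult; apply: Rmult_le_compat_r; lra.
Qed.

(** * Double integration in time *)

(** The solution of [w'' = phi], [w 0 = w' 0 = 0]. *)
Definition dint (phi : R -> R) (t : R) : R := RInt (fun s => (t - s) * phi s) 0 t.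

Lemma cont_ex_RInt (f : R -> R) a b : (forall s, continuity_pt f s) -> ex_RInt f a b.
Proof.
by move=> h; apply: ex_RInt_continuous => s _; apply/continuity_pt_filterlim.
Qed.

Lemma cont_kernel phi t s : (forall s, continuity_pt phi s) ->
  continuity_pt (fun s => (t - s) * phi s) s.
Proof.
move=> h; apply: continuity_pt_mult => //.
by apply: continuity_pt_minus; [apply: continuity_pt_const => ? | apply: continuity_pt_id].
Qed.

Lemma dint_bound phi t e : 0 <= t <= L -> (forall s, continuity_pt phi s) ->
  (forall s, 0 <= s <= L -> Rabs (phi s) <= e) -> Rabs (dint phi t) <= t ^ 2 * e.
Proof.
move=> tL hc hb.
have -> : t ^ 2 * e = (t - 0) * (t * e) by ring.
apply: abs_RInt_le_const; first by lra.
  by apply: cont_ex_RInt => s; apply: cont_kernel.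
move=> s hs; rewrite Rabs_mult (Rabs_pos_eq (t - s)); last by lra.
have := hb s; have := Rabs_pos (phi s) => a /(_ _) b.
by apply: Rmult_le_compat; try apply: b; lra.
Qed.

Lemma dint_plus phi psi t : (forall s, continuity_pt phi s) -> (forall s, continuity_pt psi s) ->
  dint (fun s => phi s + psi s) t = dint phi t + dint psi t.
Proof.
move=> h1 h2.
have ex phi' : (forall s, continuity_pt phi' s) -> ex_RInt (fun s => (t - s) * phi' s) 0 t.
  by move=> h; apply: cont_ex_RInt => s; apply: cont_kernel.
rewrite /dint; apply: etrans (RInt_plus _ _ _ _ (ex _ h1) (ex _ h2)).
by apply: RInt_ext => s _; rewrite /plus /=; ring.
Qed.

Lemma dint_scal phi c t : (forall s, continuity_pt phi s) ->
  dint (fun s => c * phi s) t = c * dint phi t.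
Proof.
move=> h.
have ex : ex_RInt (fun s => (t - s) * phi s) 0 t by apply: cont_ex_RInt => s; apply: cont_kernel.
rewrite /dint; apply: etrans (RInt_scal _ _ _ c ex).
by apply: RInt_ext => s _; rewrite /scal /= /mult /=; ring.
Qed.

(** Compare with the explicit double primitive of [exp(mu s)], whose value at [0] is
    positive and may be dropped. *)
Lemma dint_exp_bound phi G mu t : 0 <= t <= L -> 0 < mu -> 0 <= G ->
  (forall s, continuity_pt phi s) ->
  (forall s, 0 <= s <= L -> Rabs (phi s) <= G * exp (mu * s)) ->
  Rabs (dint phi t) <= G / mu ^ 2 * exp (mu * t).
Proof.
move=> tL mu0 G0 hc hb.
(* A primitive of [(t - s) G exp(mu s)]. *)
pose P s := G * ((t - s) * exp (mu * s) / mu + exp (mu * s) / mu ^ 2).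
have dP s : is_derive P s ((t - s) * (G * exp (mu * s))).
  by rewrite /P; auto_derive => //; field; lra.
have hI : is_RInt (fun s => (t - s) * (G * exp (mu * s))) 0 t (minus (P t) (P 0)).
  apply: (is_RInt_derive P) => s _; first exact: dP.
  apply/continuity_pt_filterlim; apply: cont_kernel => x.
  by apply: derivable_continuous_pt; apply: ex_derive_Reals_0; auto_derive.
apply: Rle_trans (_ : RInt (fun s => (t - s) * (G * exp (mu * s))) 0 t <= _).
  apply: Rle_trans (abs_RInt_le _ _ _ _ _) _; [lra | by apply: cont_ex_RInt => s; apply: cont_kernel |].
  apply: RInt_le; [lra | | by exists (minus (P t) (P 0)) |].
    apply: cont_ex_RInt => s.
    apply: (continuity_pt_comp (fun s => (t - s) * phi s)); first exact: cont_kernel.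
    exact: Rcontinuity_abs.
  move=> s hs; rewrite Rabs_mult Rabs_pos_eq; last by lra.
  by apply: Rmult_le_compat_l; [lra | apply: hb; lra].
rewrite (is_RInt_unique _ _ _ _ hI) /P /minus /plus /opp /=.
rewrite Rmult_0_r exp_0.
have h1 : 0 <= (t - 0) * 1 / mu + 1 / (mu * (mu * 1)).
  apply: Rplus_le_le_0_compat; apply: Rmult_le_pos; try apply/Rlt_le/Rinv_0_lt_compat; nra.
have := Rmult_le_pos _ _ G0 h1.
have -> : G * ((t - t) * exp (mu * t) / mu + exp (mu * t) / (mu * (mu * 1))) =
   G / (mu * (mu * 1)) * exp (mu * t) by field; lra.
by lra.
Qed.

(** Taylor's formula with integral remainder, for derivatives that are one-sided at the
    endpoints: both sides have the same derivatives, computed from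
    [t int_0^t g - int_0^t s g]. *)
Lemma taylor_dint w w1 g : (forall s, continuity_pt (fun s => g (clamp s)) s) ->
  (forall t, 0 <= t <= L -> deriv_in w t (w1 t)) ->
  (forall t, 0 <= t <= L -> deriv_in w1 t (g t)) -> w 0 = 0 -> w1 0 = 0 ->
  forall t, 0 <= t <= L -> w t = dint (fun s => g (clamp s)) t.
Proof.
move=> hc hw hw1 w0 w10 t tL.
pose gc s := g (clamp s).
pose I0 (t : R) : R := RInt gc 0 t; pose I1 (t : R) : R := RInt (fun s => s * gc s) 0 t.
have hc1 s : continuity_pt (fun s => s * gc s) s.
  by apply: continuity_pt_mult => //; apply: continuity_pt_id.
have dI (f : R -> R) s : (forall s, continuity_pt f s) -> is_derive (fun t => RInt f 0 t) s (f s).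
  move=> hf; apply: (is_derive_RInt f _ 0); last by apply/continuity_pt_filterlim.
  by apply: filter_forall => y; apply: RInt_correct; apply: cont_ex_RInt.
have e1 s : 0 <= s <= L -> w1 s = I0 s.
  apply: (eq_of_deriv_in (l := g)) => //; last by rewrite w10 /I0 RInt_point.
  move=> u uL; rewrite -{2}(clamp_id uL); apply: deriv_in_is_derive.
  exact: dI.
have e2 s : 0 <= s <= L -> w s = s * I0 s - I1 s.
  apply: (eq_of_deriv_in (f := w) (g := fun s => s * I0 s - I1 s) (l := w1)) => //; last by rewrite w0 /I0 /I1 !RInt_point /zero /=; ring.
  move=> u uL; apply: deriv_in_is_derive.
  have -> : w1 u = (1 * I0 u + u * gc u) - u * gc u by rewrite e1 //; ring.
  apply: is_derive_minus; last exact: (dI _ u hc1).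
  by apply: (@is_derive_mult _ (fun s => s) I0) => //; [apply: is_derive_id | apply: dI | move=> *; apply: Rmult_comm].
rewrite e2 // /dint /I0 /I1.
have -> : t * RInt gc 0 t = RInt (fun s => scal t (gc s)) 0 t.
  by apply: esym; apply: (RInt_scal gc 0 t t); apply: cont_ex_RInt.
have ex1 : ex_RInt (fun s => scal t (gc s)) 0 t by apply: ex_RInt_scal; apply: cont_ex_RInt.
have ex2 : ex_RInt (fun s => s * gc s) 0 t by apply: cont_ex_RInt.
have e := RInt_minus _ _ 0 t ex1 ex2.
apply: (etrans (esym e)).
by apply: RInt_ext => s _; rewrite /minus /plus /opp /scal /= /mult /= /gc; ring.
Qed.

End TimeInterval.

(** * A maximum principle *)

(** The symmetric second difference is nonpositive at a maximum without any
    differentiability, which is all that is known of time integrals such as [H]. *)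
Definition sdiff (f : R -> R) (d x : R) : R := f (x + d) - 2 * f x + f (x - d).

Lemma sdiff_MVT f f1 f2 d x : 0 < d ->
  (forall x, is_derive f x (f1 x)) -> (forall x, is_derive f1 x (f2 x)) ->
  exists xi, Rabs (xi - x) <= d /\ sdiff f d x = d ^ 2 * f2 xi.
Proof.
move=> d0 h1 h2.
have c1 y : continuity_pt f1 y.
  by apply: derivable_continuous_pt; apply: ex_derive_Reals_0; exists (f2 y).
have dg y : is_derive (fun y => f y - f (y - d)) y (f1 y - f1 (y - d)).
  apply: is_derive_minus; first exact: h1.
  rewrite -[f1 (y - d)]Rmult_1_l.
  apply: (is_derive_comp f (fun y => y - d)); first exact: h1.
  by auto_derive => //; ring.
have [||c [hc e]] := MVT_gen (fun y => f y - f (y - d)) x (x + d) (fun y => f1 y - f1 (y - d)).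
- by move=> y _; apply: dg.
- by move=> y _; apply: derivable_continuous_pt; apply: ex_derive_Reals_0; exists (f1 y - f1 (y - d)).
have [||k [hk e']] := MVT_gen f1 (c - d) c f2.
- by move=> y _; apply: h2.
- by move=> y _; apply: c1.
move: hc hk; rewrite !Rmin_left ?Rmax_right; try lra; move=> hc hk.
exists k; split; first by rewrite /Rabs; case: Rcase_abs; lra.
have e3 : x + d - d = x by ring.
have e4 : c - (c - d) = d by ring.
have e5 : x + d - x = d by ring.
rewrite e3 e5 in e; rewrite e4 in e'.
by rewrite /sdiff (_ : _ - _ + _ = f (x + d) - f x - (f x - f (x - d))); [rewrite e e'; ring | ring].
Qed.

(** [y - y'' = q <= eta] with [y] bounded forces [y <= eta]; the second derivative
    is only used through symmetric differences at a maximum of [y - e x^2]. *)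
Lemma max_principle (y q : R -> R) Y eta :
  (forall x, continuity_pt y x) -> (forall x, Rabs (y x) <= Y) -> (forall x, q x <= eta) ->
  (forall x e, 0 < e -> exists d, 0 < d /\
     Rabs (sdiff y d x - d ^ 2 * (y x - q x)) <= d ^ 2 * e) ->
  forall x, y x <= eta.
Proof.
move=> hc hb hq hd x; apply: le_epsilon => e' e'0.
have x2 := pow2_ge_0 x.
pose e := e' / (3 + x ^ 2).
have e0 : 0 < e by apply: Rdiv_lt_0_compat; lra.
have Y0 : 0 <= Y by apply: Rle_trans (hb 0); apply: Rabs_pos.
(* Beyond this radius [e x^2] exceeds the oscillation [2 Y] of [y]. *)
pose rad := 2 * Y / e + 1.
have rad1 : 1 <= rad.
  have : 0 <= 2 * Y / e by apply: Rmult_le_pos; [lra | apply/Rlt_le/Rinv_0_lt_compat].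
  by rewrite /rad; lra.
have erad : e * rad = 2 * Y + e by rewrite /rad; field; lra.
pose g x := y x - e * x ^ 2.
have [||m [hm mr]] := continuity_ab_maj g (- rad) rad; first by lra.
  move=> z _; apply: continuity_pt_minus => //; apply: continuity_pt_mult.
    by apply: continuity_pt_const => ?.
  by apply: derivable_continuous_pt; apply: derivable_pt_pow.
have gmax z : g z <= g m.
  case: (Rle_dec (Rabs z) rad) => hz.
    by apply: hm; move: hz; rewrite /Rabs; case: Rcase_abs; lra.
  apply: Rle_trans (hm 0 _); last by lra.
  have z2 : rad <= z ^ 2.
    rewrite -(pow2_abs z); have : rad < Rabs z by lra.
    by nra.
  have := Rmult_le_compat_l _ _ _ (Rlt_le _ _ e0) z2.
  have := hb z; have := hb 0; rewrite /g /Rabs; do 2 case: Rcase_abs; lra.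
have [d [d0 hdd]] := hd m e e0.
have d2 : 0 < d ^ 2 by apply: pow_lt.
have g1 := gmax (m + d); have g2 := gmax (m - d); rewrite /g in g1 g2.
have sd : sdiff y d m <= 2 * e * d ^ 2 by rewrite /sdiff; nra.
have : d ^ 2 * (y m - q m) <= d ^ 2 * (3 * e).
  by move: hdd; rewrite /Rabs; case: Rcase_abs; lra.
move/(Rmult_le_reg_l _ _ _ d2) => ym.
have := gmax x; rewrite /g; have := hq m; have := pow2_ge_0 m => m2.
have : e' = e * (3 + x ^ 2) by rewrite /e; field; lra.
nra.
Qed.

(** * The linear problem on a strip *)

Section Strip.
Variable L : R.
Hypothesis L0 : 0 < L.
Implicit Types g z : R -> R -> R.

(** Joint continuity on the strip, extended beyond it by clamping the time. *)
Definition cont_strip g : Prop := forall t x, continuity_2d_pt (fun s y => g (clamp L s) y) t x.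

Lemma cont_strip_t g x s : cont_strip g -> continuity_pt (fun s => g (clamp L s) x) s.
Proof.
move=> h e e0; have [d hd] := h s x (mkposreal _ e0).
exists d; split; first exact: cond_pos.
move=> u [_]; rewrite /= /R_dist => us; apply: hd => //.
by rewrite Rminus_diag Rabs_R0; apply: cond_pos.
Qed.

(** Equicontinuity in space, uniformly in time, by compactness of the time interval. *)
Lemma cont_strip_tube g x e : cont_strip g -> 0 < e -> exists d, 0 < d /\
  forall s y, 0 <= s <= L -> Rabs (y - x) <= d -> Rabs (g s y - g s x) <= e.
Proof.
move=> h e0.
have [d hd] := uniform_continuity_2d_1d _ 0 L x (fun s _ => h s x) (mkposreal _ e0).
exists d; split; first exact: cond_pos.
move=> s y sL yx; have d0 := cond_pos d.
have := hd s x s y sL; rewrite !(clamp_id sL) /= => q.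
apply: Rlt_le; apply: q => //; first by lra.
  by move: yx; rewrite /Rabs; case: Rcase_abs; lra.
by rewrite Rminus_diag Rabs_R0.
Qed.

Lemma cont_strip_near g t x : cont_strip g -> 0 <= t <= L -> exists d, 0 < d /\
  forall s y, 0 <= s <= L -> Rabs (s - t) < d -> Rabs (y - x) < d -> Rabs (g s y) <= Rabs (g t x) + 1.
Proof.
move=> h tL; have [d hd] := h t x (mkposreal _ Rlt_0_1).
exists d; split; first exact: cond_pos.
move=> s y sL st yx; have := hd s y st yx; rewrite !clamp_id //=.
have := Rabs_triang (g s y - g t x) (g t x).
rewrite (_ : g s y - g t x + g t x = g s y); last by ring.
lra.
Qed.

Lemma between_abs a b c t d : a <= c <= b -> Rabs (a - t) < d -> Rabs (b - t) < d -> Rabs (c - t) < d.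
Proof. by rewrite /Rabs; repeat case: Rcase_abs; lra. Qed.

(** A locally bounded time derivative makes continuity in time locally uniform in
    space. *)
Lemma cont_strip_of_dt z zt : cont_strip zt ->
  (forall t x, 0 <= t <= L -> deriv_in L (fun s => z s x) t (zt t x)) ->
  (forall t x, 0 <= t <= L -> continuity_pt (z t) x) -> cont_strip z.
Proof.
move=> hc hd hx t x e.
pose t' := clamp L t; have tL : 0 <= t' <= L by apply: clamp_in.
have [d [d0 hK]] := cont_strip_near x hc tL.
set K := Rabs _ + 1 in hK; have K0 : 0 < K by rewrite /K; have := Rabs_pos (zt t' x); lra.
have e2 : 0 < e / 2 by have := cond_pos e; lra.
have [d1 [d10 hd1]] := hx t' x tL _ e2.
have m0 : 0 < Rmin d (Rmin d1 (e / 2 / K)).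
  by do ! apply: Rmin_glb_lt => //; apply: Rdiv_lt_0_compat.
exists (mkposreal _ m0) => s y /= st yx.
have st1 := Rlt_le_trans _ _ _ st (Rmin_l _ _); have st2 := Rlt_le_trans _ _ _ st (Rmin_r _ _).
have st3 := Rlt_le_trans _ _ _ st2 (Rmin_r _ _).
have yx1 := Rlt_le_trans _ _ _ yx (Rmin_l _ _); have yx2 := Rlt_le_trans _ _ _ yx (Rmin_r _ _).
have yx3 := Rlt_le_trans _ _ _ yx2 (Rmin_l _ _).
have cl := clamp_lipschitz L s t; rewrite -/t' in cl *.
pose s' := clamp L s; have sL : 0 <= s' <= L by apply: clamp_in.
rewrite -/s' in cl *.
have lip : Rabs (z s' y - z t' y) <= K * Rabs (s' - t').
  have tt : Rabs (t' - t') < d by rewrite Rminus_diag Rabs_R0.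
  have ss : Rabs (s' - t') < d by lra.
  case: (Rle_or_lt s' t') => le.
    have [c [hc' e']] := MVT_in L0 (proj1 sL) le (proj2 tL) (fun t tL => hd t y tL).
    rewrite Rabs_minus_sym e' Rabs_mult (Rabs_minus_sym t'); apply: Rmult_le_compat_r; first exact: Rabs_pos.
    by apply: hK => //; [lra | apply: between_abs hc' _ _].
  have [c [hc' e']] := MVT_in L0 (proj1 tL) (Rlt_le _ _ le) (proj2 sL) (fun t tL => hd t y tL).
  rewrite e' Rabs_mult; apply: Rmult_le_compat_r; first exact: Rabs_pos.
  by apply: hK => //; [lra | apply: between_abs hc' _ _].
have h2 : Rabs (z t' y - z t' x) < e / 2.
  case: (Req_dec x y) => [->|ne]; first by rewrite Rminus_diag Rabs_R0.
  by apply: hd1; split.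
have h3 : K * Rabs (s' - t') < e / 2.
  have -> : e / 2 = K * (e / 2 / K) by field; lra.
  by apply: Rmult_lt_compat_l => //; lra.
have := Rabs_triang (z s' y - z t' y) (z t' y - z t' x).
rewrite (_ : z s' y - z t' y + (z t' y - z t' x) = z s' y - z t' x); last by ring.
lra.
Qed.

(** If [z] and [z_t] vanish initially, so does [z_xxt]: otherwise [z_xx] would grow
    linearly in time with a constant sign near a point, and so would a symmetric
    difference of [z], although [z = o(t)]. *)
Lemma initial_velocity_xx z zx zxx zxxt zxxtt :
  (forall t x, 0 <= t <= L -> is_derive (z t) x (zx t x)) ->
  (forall t x, 0 <= t <= L -> is_derive (zx t) x (zxx t x)) ->
  (forall t x, 0 <= t <= L -> deriv_in L (fun s => zxx s x) t (zxxt t x)) ->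
  (forall t x, 0 <= t <= L -> deriv_in L (fun s => zxxt s x) t (zxxtt t x)) ->
  cont_strip zxx -> cont_strip zxxtt ->
  (forall x, z 0 x = 0) -> (forall x, zxx 0 x = 0) -> (forall x, deriv_in L (fun s => z s x) 0 0) ->
  forall x, zxxt 0 x = 0.
Proof.
move=> dz dzx dzxx dzxxt cxx cxxtt z0 zxx0 dz0 x0; apply: NNPP => ne.
pose P := Rabs (zxxt 0 x0); have P0 : 0 < P by apply: Rabs_pos_lt.
have tz : 0 <= 0 <= L by lra.
have [d [d0 hK]] := cont_strip_near x0 cxxtt tz.
set K := Rabs _ + 1 in hK; have K0 : 0 < K by rewrite /K; have := Rabs_pos (zxxtt 0 x0); lra.
have taylor t x : 0 <= t <= L -> t < d -> Rabs (x - x0) < d ->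
    Rabs (zxx t x - t * zxxt 0 x) <= K * t ^ 2.
  move=> tL td xd.
  have [c [hc e1]] := MVT_in L0 (proj1 tz) (proj1 tL) (proj2 tL) (fun t tL => dzxx t x tL).
  have cL : 0 <= c <= L by lra.
  have [b [hb e2]] := MVT_in L0 (proj1 tz) (proj1 cL) (proj2 cL) (fun t tL => dzxxt t x tL).
  have bK : Rabs (zxxtt b x) <= K.
    by apply: hK => //; [lra | rewrite Rminus_0_r Rabs_pos_eq; lra].
  rewrite zxx0 !Rminus_0_r in e1 e2; rewrite e1.
  have -> : zxxt c x * t - t * zxxt 0 x = zxxtt b x * (c * t) by rewrite -[zxxt c x](Rplus_minus (zxxt 0 x)) e2; ring.
  rewrite Rabs_mult (Rabs_pos_eq (c * t)); last by apply: Rmult_le_pos; lra.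
  apply: Rmult_le_compat => //; [exact: Rabs_pos | nra | nra].
(* Near [x0] and for [t <= t1], [z_xx / t] stays within [4 e = P / 2] of [z_xxt(0, x0)]:
   [K t] for the Taylor remainder, [3 e] for the variation of [z_xxt(0, .)]. *)
pose e := P / 8; have e0 : 0 < e by rewrite /e; lra.
pose t1 := Rmin (d / 2) (Rmin L (e / K)).
have eK : 0 < e / K by apply: Rdiv_lt_0_compat.
have t10 : 0 < t1 by rewrite /t1; do ! apply: Rmin_glb_lt; lra.
have t1d : t1 <= d / 2 by apply: Rmin_l.
have t1L : t1 <= L by apply: Rle_trans (Rmin_r _ _) (Rmin_l _ _).
have t1K : K * t1 <= e.
  have -> : e = K * (e / K) by field; lra.
  by apply: Rmult_le_compat_l; [lra | apply: Rle_trans (Rmin_r _ _) (Rmin_r _ _)].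
have et1 : 0 < e * t1 by apply: Rmult_lt_0_compat.
have [d' [d'0 hd']] := cont_strip_tube x0 cxx et1.
pose r := Rmin d' (d / 2); have r0 : 0 < r by apply: Rmin_glb_lt; lra.
have rd' : r <= d' by apply: Rmin_l. have rd : r <= d / 2 by apply: Rmin_r.
have pvar x : Rabs (x - x0) <= r -> Rabs (zxxt 0 x - zxxt 0 x0) <= 3 * e.
  move=> xr; have t1i : 0 <= t1 <= L by lra.
  have h1 := taylor t1 x t1i.
  have h2 := taylor t1 x0 t1i.
  have h3 : Rabs (zxx t1 x - zxx t1 x0) <= e * t1 by apply: hd'; lra.
  have h1' : Rabs (zxx t1 x - t1 * zxxt 0 x) <= e * t1 by apply: Rle_trans (h1 _ _) _; nra.
  have h2' : Rabs (zxx t1 x0 - t1 * zxxt 0 x0) <= e * t1.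
    by apply: Rle_trans (h2 _ _) _; [lra | rewrite Rminus_diag Rabs_R0 | nra].
  apply: (Rmult_le_reg_l t1) => //.
  rewrite -{1}(Rabs_pos_eq t1); last by lra.
  rewrite -Rabs_mult.
  by move: h1' h2' h3; rewrite /Rabs; repeat case: Rcase_abs; lra.
have low t x : 0 <= t <= t1 -> Rabs (x - x0) <= r -> t * (P / 2) <= Rabs (zxx t x).
  move=> tt xr; have tL : 0 <= t <= L by lra.
  have h1 : Rabs (zxx t x - t * zxxt 0 x) <= K * t ^ 2 by apply: taylor; lra.
  have h2 := Rmult_le_compat_l _ _ _ (proj1 tt) (pvar x xr).
  have h3 : K * t ^ 2 <= e * t.
    have : K * t <= e by apply: Rle_trans t1K; apply: Rmult_le_compat_l; lra.
    by nra.
  have h4 : t * P <= Rabs (t * zxxt 0 x) + t * Rabs (zxxt 0 x - zxxt 0 x0).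
    rewrite Rabs_mult (Rabs_pos_eq t) -?Rmult_plus_distr_l; last by lra.
    apply: Rmult_le_compat_l; first by lra.
    by rewrite /P /Rabs; repeat case: Rcase_abs; lra.
  have h5 : Rabs (t * zxxt 0 x) <= Rabs (zxx t x) + Rabs (zxx t x - t * zxxt 0 x).
    by rewrite /Rabs; repeat case: Rcase_abs; lra.
  by rewrite /e in h2 h3; lra.
pose n := r ^ 2 * P / 16.
have r2 : 0 < r ^ 2 by apply: pow_lt.
have n0 : 0 < n by rewrite /n; nra.
have [a1 [a10 h1]] := dz0 (x0 + r) _ n0.
have [a2 [a20 h2]] := dz0 x0 _ n0.
have [a3 [a30 h3]] := dz0 (x0 - r) _ n0.
pose t := Rmin t1 (Rmin (a1 / 2) (Rmin (a2 / 2) (a3 / 2))).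
have t0 : 0 < t by rewrite /t; do ! apply: Rmin_glb_lt; lra.
have tt1 : t <= t1 by apply: Rmin_l.
have ta1 : t <= a1 / 2 by apply: Rle_trans (Rmin_r _ _) (Rmin_l _ _).
have ta2 : t <= a2 / 2.
  by apply: Rle_trans (Rmin_r _ _) (Rle_trans _ _ _ (Rmin_r _ _) (Rmin_l _ _)).
have ta3 : t <= a3 / 2.
  by apply: Rle_trans (Rmin_r _ _) (Rle_trans _ _ _ (Rmin_r _ _) (Rmin_r _ _)).
have tL : 0 <= t <= L by lra.
have small y a : (forall s, 0 <= s <= L -> Rabs (s - 0) < a ->
    Rabs (z s y - z 0 y - (s - 0) * 0) <= n * Rabs (s - 0)) -> t <= a / 2 -> Rabs (z t y) <= n * t.
  move=> h ta; have := h t tL; rewrite z0 Rmult_0_r !Rminus_0_r (Rabs_pos_eq t); last by lra.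
  by apply; lra.
have s1 := small _ _ h1 ta1; have s2 := small _ _ h2 ta2; have s3 := small _ _ h3 ta3.
have [xi [hxi exi]] := sdiff_MVT x0 r0 (fun x => dz t x tL) (fun x => dzx t x tL).
have := low t xi (conj (Rlt_le _ _ t0) tt1) hxi => lw.
have : Rabs (sdiff (z t) r x0) <= 4 * (n * t).
  by move: s1 s2 s3; rewrite /sdiff /Rabs; repeat case: Rcase_abs; lra.
rewrite exi Rabs_mult (Rabs_pos_eq (r ^ 2)); last by lra.
have := Rmult_le_compat_l _ _ _ (Rlt_le _ _ r2) lw.
have : 0 < r ^ 2 * (t * P) by apply: Rmult_lt_0_compat => //; apply: Rmult_lt_0_compat.
rewrite /n; lra.
Qed.

(** The a priori estimate: with [H] the twice time-integrated source, [y = z + H]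
    solves [y - y_xx = H], so that [|z| <= |y| + |H| <= 2 sup |H|]. *)
Lemma linear_estimate z zt ztt zx zxx zxxt zxxtt h hx hxx Z G mu :
  (forall t x, 0 <= t <= L -> deriv_in L (fun s => z s x) t (zt t x)) ->
  (forall t x, 0 <= t <= L -> deriv_in L (fun s => zt s x) t (ztt t x)) ->
  (forall t x, 0 <= t <= L -> is_derive (z t) x (zx t x)) ->
  (forall t x, 0 <= t <= L -> is_derive (zx t) x (zxx t x)) ->
  (forall t x, 0 <= t <= L -> deriv_in L (fun s => zxx s x) t (zxxt t x)) ->
  (forall t x, 0 <= t <= L -> deriv_in L (fun s => zxxt s x) t (zxxtt t x)) ->
  (forall t x, 0 <= t <= L -> is_derive (h t) x (hx t x)) ->
  (forall t x, 0 <= t <= L -> is_derive (hx t) x (hxx t x)) ->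
  cont_strip zxx -> cont_strip zxxtt -> cont_strip h -> cont_strip hxx ->
  (forall t x, 0 <= t <= L -> ztt t x - zxxtt t x = hxx t x) ->
  (forall x, z 0 x = 0) -> (forall x, zt 0 x = 0) ->
  (forall t x, 0 <= t <= L -> Rabs (z t x) <= Z) ->
  0 < mu -> 0 <= G ->
  (forall t x, 0 <= t <= L -> Rabs (h t x) <= G * exp (mu * t)) ->
  forall t x, 0 <= t <= L -> Rabs (z t x) <= 2 * (G / mu ^ 2 * exp (mu * t)).
Proof.
move=> dz dzt dzx dzxx dzxxt dzxxtt dh dhx cxx cxxtt ch chxx eqn z0 zt0 zb mu0 G0 hb t x tL.
have tz : 0 <= 0 <= L by lra.
have zx0 y : zx 0 y = 0.
  rewrite -(is_derive_unique _ _ _ (dzx 0 y tz)) -[RHS](Derive_const 0 y).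
  by apply: Derive_ext => u; rewrite z0.
have zxx0 y : zxx 0 y = 0.
  rewrite -(is_derive_unique _ _ _ (dzxx 0 y tz)) -[RHS](Derive_const 0 y).
  by apply: Derive_ext => u; rewrite zx0.
have zxxt0 : forall y, zxxt 0 y = 0.
  apply: (initial_velocity_xx dzx dzxx dzxxt dzxxtt cxx cxxtt z0 zxx0) => y.
  by have := dz 0 y tz; rewrite zt0.
have repr y : z t y - zxx t y = dint (fun s => hxx (clamp L s) y) t.
  apply: (@taylor_dint L L0 (fun s => z s y - zxx s y) (fun s => zt s y - zxxt s y) (fun s => hxx s y)) => //.
  - by move=> s; apply: cont_strip_t.
  - by move=> s sL; apply: deriv_in_minus; [apply: dz | apply: dzxxt].
  - by move=> s sL; rewrite -eqn //; apply: deriv_in_minus; [apply: dzt | apply: dzxxtt].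
  - by rewrite z0 zxx0; ring.
  - by rewrite zt0 zxxt0; ring.
pose H y := dint (fun s => h (clamp L s) y) t.
set eta := G / mu ^ 2 * exp (mu * t).
have Hb y : Rabs (H y) <= eta.
  apply: (dint_exp_bound tL mu0 G0) => [s|s sL]; first exact: cont_strip_t.
  by rewrite (clamp_id sL); apply: hb.
have contH y : forall s, continuity_pt (fun s => h (clamp L s) y) s by move=> s; apply: cont_strip_t.
have cs c y : forall s, continuity_pt (fun s => c * h (clamp L s) y) s.
  by move=> s; apply: continuity_pt_mult (contH y s); apply: continuity_pt_const => ?.
have t2 := pow2_ge_0 t.
have cH y : continuity_pt H y.
  move=> e e0; have e1 : 0 < e / (t ^ 2 + 1) by apply: Rdiv_lt_0_compat; lra.
  have [d [d0 hd]] := cont_strip_tube y ch e1.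
  exists d; split=> // u [_]; rewrite /= /R_dist => uy.
  have -> : H u - H y = dint (fun s => h (clamp L s) u + -1 * h (clamp L s) y) t.
    by rewrite dint_plus ?dint_scal //; rewrite /H; ring.
  apply: Rle_lt_trans (_ : t ^ 2 * (e / (t ^ 2 + 1)) < e).
    apply: (dint_bound tL) => [s|s sL]; first by apply: continuity_pt_plus.
    rewrite (clamp_id sL) (_ : _ + _ = h s u - h s y); last by ring.
    by apply: hd; lra.
  have {2}-> : e = (t ^ 2 + 1) * (e / (t ^ 2 + 1)) by field; lra.
  by apply: Rmult_lt_compat_r; lra.
have sH y e : 0 < e -> exists d0, 0 < d0 /\ forall d, 0 < d <= d0 ->
   Rabs (sdiff H d y - d ^ 2 * (z t y - zxx t y)) <= d ^ 2 * e.
  move=> e0; have e1 : 0 < e / (t ^ 2 + 1) by apply: Rdiv_lt_0_compat; lra.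
  have [d0 [d00 hd]] := cont_strip_tube y chxx e1.
  exists d0; split=> // d dd.
  have cg s : continuity_pt (fun s => - d ^ 2 * hxx (clamp L s) y) s.
    by apply: continuity_pt_mult; [apply: continuity_pt_const => ? | apply: cont_strip_t].
  have c1 s : continuity_pt (fun s => -2 * h (clamp L s) y + - d ^ 2 * hxx (clamp L s) y) s.
    by apply: continuity_pt_plus.
  have c2 s : continuity_pt (fun s => h (clamp L s) (y - d) + (-2 * h (clamp L s) y + - d ^ 2 * hxx (clamp L s) y)) s.
    by apply: continuity_pt_plus.
  have c3 s : continuity_pt (fun s => h (clamp L s) (y + d) + (h (clamp L s) (y - d) + (-2 * h (clamp L s) y + - d ^ 2 * hxx (clamp L s) y))) s.
    by apply: continuity_pt_plus.
  have -> : sdiff H d y - d ^ 2 * (z t y - zxx t y) =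
     dint (fun s => h (clamp L s) (y + d) + (h (clamp L s) (y - d) + (-2 * h (clamp L s) y + - d ^ 2 * hxx (clamp L s) y))) t.
    have chx s : continuity_pt (fun s => hxx (clamp L s) y) s by apply: cont_strip_t.
    rewrite !dint_plus // !dint_scal // repr /sdiff /H; ring.
  apply: Rle_trans (_ : t ^ 2 * (d ^ 2 * (e / (t ^ 2 + 1))) <= _).
    apply: (dint_bound tL) => [//|s sL]; rewrite (clamp_id sL).
    have [xi [hxi exi]] := sdiff_MVT y (proj1 dd) (fun x => dh s x sL) (fun x => dhx s x sL).
    rewrite (_ : _ + _ = sdiff (h s) d y - d ^ 2 * hxx s y); last by rewrite /sdiff; ring.
    rewrite exi -Rmult_minus_distr_l Rabs_mult (Rabs_pos_eq _ (pow2_ge_0 d)).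
    apply: Rmult_le_compat_l; first exact: pow2_ge_0.
    by apply: hd; lra.
  have d2 := pow2_ge_0 d.
  rewrite -Rmult_assoc (Rmult_comm (t ^ 2)) Rmult_assoc; apply: Rmult_le_compat_l => //.
  have {2}-> : e = (t ^ 2 + 1) * (e / (t ^ 2 + 1)) by field; lra.
  by apply: Rmult_le_compat_r; lra.
have key sg : sg = 1 \/ sg = -1 -> forall y, sg * (z t y + H y) <= eta.
  move=> hsg.
  have asg u : Rabs (sg * u) = Rabs u.
    by rewrite Rabs_mult; case: hsg => ->; rewrite ?Rabs_Ropp ?Rabs_R1 ?(Rabs_left (-1)); lra.
  apply: (@max_principle _ (fun y => sg * H y) (Z + eta)) => [y|y|y|y e e0].
  - apply: continuity_pt_mult; first by apply: continuity_pt_const => ?.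
    apply: continuity_pt_plus (cH y).
    by apply: derivable_continuous_pt; apply: ex_derive_Reals_0; exists (zx t y); apply: dzx.
  - rewrite asg; apply: Rle_trans (Rabs_triang _ _) _.
    by apply: Rplus_le_compat; [apply: zb | apply: Hb].
  - by apply: Rle_trans (Rle_abs _) _; rewrite asg; apply: Hb.
  have e2 : 0 < e / 2 by lra.
  have [d1 [d10 h1]] := sH y _ e2; have [d2 [d20 h2]] := cont_strip_tube y cxx e2.
  pose d := Rmin d1 d2; have d0 : 0 < d by apply: Rmin_glb_lt.
  have dd1 : d <= d1 by apply: Rmin_l. have dd2 : d <= d2 by apply: Rmin_r.
  exists d; split=> //.
  have [xi [hxi exi]] := sdiff_MVT y d0 (fun x => dzx t x tL) (fun x => dzxx t x tL).
  have -> : sdiff (fun y => sg * (z t y + H y)) d y - d ^ 2 * (sg * (z t y + H y) - sg * H y) =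
     sg * ((sdiff (z t) d y - d ^ 2 * zxx t y) + (sdiff H d y - d ^ 2 * (z t y - zxx t y))).
    by rewrite /sdiff; ring.
  rewrite asg exi -Rmult_minus_distr_l; apply: Rle_trans (Rabs_triang _ _) _.
  rewrite Rabs_mult (Rabs_pos_eq _ (pow2_ge_0 d)).
  have q1 := Rmult_le_compat_l _ _ _ (pow2_ge_0 d) (h2 t xi tL (Rle_trans _ _ _ hxi dd2)).
  have q2 := h1 d (conj d0 dd1); lra.
have k1 := key 1 (or_introl erefl) x; have k2 := key (-1) (or_intror erefl) x.
by have := Hb x; rewrite /Rabs; repeat case: Rcase_abs; lra.
Qed.

End Strip.

(** * Uniqueness *)

Section Components.
Variable pr : C -> R.
Hypothesis prE : pr = fst \/ pr = snd.

Lemma pr_minus a b : pr (Cminus a b) = pr a - pr b.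
Proof. by case: prE => ->. Qed.

Lemma pr_plus a b : pr (Cplus a b) = pr a + pr b.
Proof. by case: prE => ->. Qed.

Lemma pr_le a : Rabs (pr a) <= Cmod a.
Proof. by have [h1 [h2 _]] := Cmod_components a; case: prE => ->. Qed.

Lemma pr_filterdiff (F : (R -> Prop) -> Prop) (f : R -> C) l : Filter F ->
  filterdiff (U := R_NormedModule) (V := C_R_NormedModule) f F (fun h => scal h l) ->
  filterdiff (U := R_NormedModule) (V := R_NormedModule) (fun x => pr (f x)) F (fun h => scal h (pr l)).
Proof.
move=> hF [_ hd]; split; first exact: is_linear_scal_l.
move=> x hx e; move: (hd x hx e); apply: filter_imp => y.
move=> h; apply: Rle_trans h; rewrite norm_Cmod.
set w := (X in Cmod X).
have -> : minus (minus (pr (f y)) (pr (f x))) (scal (minus y x) (pr l)) = pr w.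
  by rewrite /w; case: prE => ->; reflexivity.
exact: pr_le.
Qed.

Lemma pr_is_derive f x l : is_derive_x f x l -> is_derive (fun y => pr (f y)) x (pr l).
Proof. by apply: pr_filterdiff. Qed.

Lemma pr_deriv_in L f t l : 0 <= t <= L -> is_derive_t L f t l -> deriv_in L (fun s => pr (f s)) t (pr l).
Proof.
move=> tL /pr_filterdiff [_ h] e e0.
have lim : is_filter_lim (within (fun s => 0 <= s <= L) (locally t)) t.
  by move=> P; apply: filter_imp.
have [d hd] := h t lim (mkposreal _ e0).
exists d; split; first exact: cond_pos.
by move=> s sL st; apply: hd.
Qed.

Lemma pr_cont_strip L g : 0 < L -> continuous_strip L g -> cont_strip L (fun t x => pr (g t x)).
Proof.
move=> L0 h t x e.
have [d hd] := h (clamp L t, x) (clamp_in L0 t) _ (@locally_ball C_UniformSpace _ e).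
exists d => s y st yx.
have cl := clamp_lipschitz L s t.
have [b1 b2] := hd (clamp L s, y) (conj (Rle_lt_trans _ _ _ cl st) yx) (clamp_in L0 s).
by case: prE => ->.
Qed.

End Components.

Section Uniqueness.
Variables (nu : nat) (omega : 'I_nu -> R) (c d : Zvec nu -> C) (L : R).
Hypothesis L0 : 0 < L.

Lemma classical_cont_strip u pr : pr = fst \/ pr = snd -> classical_solution omega c d L u ->
  cont_strip L (fun t x => pr (u t x)).
Proof.
move=> hpr [ut [utt [ux [uxx [uxxt [uxxtt [sqx [sqxx [[dt1 _] [[dx1 _] [_ [_ [[ct _] _]]]]]]]]]]]]].
apply: (@cont_strip_of_dt L L0 _ (fun t x => pr (ut t x))).
- exact: pr_cont_strip.
- by move=> t x tL; apply: pr_deriv_in => //; apply: dt1.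
- move=> t x tL; apply: derivable_continuous_pt; apply: ex_derive_Reals_0.
  by exists (pr (ux t x)); apply: pr_is_derive => //; apply: dx1.
Qed.

(** The components of [u^2] are polynomials in both components of [u]. *)
Lemma sqr_cont_strip u pr : pr = fst \/ pr = snd -> classical_solution omega c d L u ->
  cont_strip L (fun t x => pr (Cmult (u t x) (u t x))).
Proof.
move=> hpr cu.
have c1 := classical_cont_strip (or_introl erefl) cu.
have c2 := classical_cont_strip (or_intror erefl) cu.
by case: hpr => -> t x;
  [apply: continuity_2d_pt_minus | apply: continuity_2d_pt_plus]; apply: continuity_2d_pt_mult;
  try apply: c1; apply: c2.
Qed.

Definition source (u v : R -> R -> C) t x : C :=
  Cplus (Cminus (v t x) (u t x)) (Cminus (Cmult (v t x) (v t x)) (Cmult (u t x) (u t x))).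

(** The maximum principle is about real functions, so it is applied to the real and
    imaginary parts of the difference; the source couples them only through its
    modulus. *)
Lemma component_estimate u v pr Z G mu : pr = fst \/ pr = snd ->
  classical_solution omega c d L u -> classical_solution omega c d L v ->
  (forall t x, 0 <= t <= L -> Cmod (Cminus (v t x) (u t x)) <= Z) ->
  0 < mu -> 0 <= G ->
  (forall t x, 0 <= t <= L -> Cmod (source u v t x) <= G * exp (mu * t)) ->
  forall t x, 0 <= t <= L -> Rabs (pr (Cminus (v t x) (u t x))) <= 2 * (G / mu ^ 2 * exp (mu * t)).
Proof.
move=> hpr cu cv zb mu0 G0 hb.
have cu1 := classical_cont_strip hpr cu; have cv1 := classical_cont_strip hpr cv.
have cu2 := sqr_cont_strip hpr cu; have cv2 := sqr_cont_strip hpr cv.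
case: cu => ut [utt [ux [uxx [uxxt [uxxtt [usq [usqq [[u1 u2] [[u3 u4] [[u5 u6] [[u7 u8] [[u9 [u10 [u11 [u12 u13]]]] [u14 [u15 u16]]]]]]]]]]]]]].
case: cv => vt [vtt [vx [vxx [vxxt [vxxtt [vsq [vsqq [[v1 v2] [[v3 v4] [[v5 v6] [[v7 v8] [[v9 [v10 [v11 [v12 v13]]]] [v14 [v15 v16]]]]]]]]]]]]]].
have D (f g : R -> R -> C) f' g' : partial_t L f f' -> partial_t L g g' ->
    forall t x, 0 <= t <= L -> deriv_in L (fun s => pr (g s x) - pr (f s x)) t (pr (g' t x) - pr (f' t x)).
  by move=> hf hg t x tL; apply: deriv_in_minus; apply: pr_deriv_in => //; [apply: hg | apply: hf].
have X (f g : R -> R -> C) f' g' : partial_x L f f' -> partial_x L g g' ->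
    forall t x, 0 <= t <= L -> is_derive (fun y => pr (g t y) - pr (f t y)) x (pr (g' t x) - pr (f' t x)).
  by move=> hf hg t x tL; apply: is_derive_minus; apply: pr_is_derive => //; [apply: hg | apply: hf].
have CS (f g : R -> R -> C) : continuous_strip L f -> continuous_strip L g ->
    cont_strip L (fun t x => pr (g t x) - pr (f t x)).
  move=> hf hg t x; apply: continuity_2d_pt_minus.
    exact: (pr_cont_strip hpr L0 hg).
  exact: (pr_cont_strip hpr L0 hf).
have tz : 0 <= 0 <= L by lra.
move=> t x tL; rewrite (pr_minus hpr).
apply: (@linear_estimate L L0 (fun t x => pr (v t x) - pr (u t x)) (fun t x => pr (vt t x) - pr (ut t x))
  (fun t x => pr (vtt t x) - pr (utt t x)) (fun t x => pr (vx t x) - pr (ux t x))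
  (fun t x => pr (vxx t x) - pr (uxx t x)) (fun t x => pr (vxxt t x) - pr (uxxt t x))
  (fun t x => pr (vxxtt t x) - pr (uxxtt t x))
  (fun t x => (pr (v t x) - pr (u t x)) + (pr (Cmult (v t x) (v t x)) - pr (Cmult (u t x) (u t x))))
  (fun t x => (pr (vx t x) - pr (ux t x)) + (pr (vsq t x) - pr (usq t x)))
  (fun t x => (pr (vxx t x) - pr (uxx t x)) + (pr (vsqq t x) - pr (usqq t x))) Z G mu) => //.
- exact: D.
- exact: D.
- exact: X.
- exact: X.
- exact: D.
- exact: D.
- by move=> s y sL; apply: is_derive_plus; [apply: X | apply: (X (fun t x => Cmult (u t x) (u t x)) (fun t x => Cmult (v t x) (v t x)))].
- by move=> s y sL; apply: is_derive_plus; apply: X.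
- exact: CS.
- exact: CS.
- by move=> s y; apply: continuity_2d_pt_plus; apply: continuity_2d_pt_minus; [apply: cv1 | apply: cu1 | apply: cv2 | apply: cu2].
- by move=> s y; apply: continuity_2d_pt_plus; apply: CS.
- move=> s y sL.
  have pr0 : pr (RtoC 0) = 0 by case: hpr => ->.
  have := congr1 pr (u14 s y sL); have := congr1 pr (v14 s y sL).
  by rewrite !(pr_minus hpr) pr0; lra.
- by move=> y; rewrite (is_sum_unique (v15 y) (u15 y)); ring.
- by move=> y; rewrite (is_sum_unique (v16 y) (u16 y)); ring.
- by move=> s y sL; rewrite -(pr_minus hpr); apply: Rle_trans (zb s y sL); apply: pr_le.
- move=> s y sL; rewrite -!(pr_minus hpr) -(pr_plus hpr); apply: Rle_trans (hb s y sL); exact: pr_le.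
Qed.

(** The estimate gains a factor [1/2] in the weighted bound [sup e^(- mu t) |v - u|]
    once [mu] is large compared with the Lipschitz constant of [v + v^2]. *)
Lemma bounded_uniqueness u v V :
  classical_solution omega c d L u -> classical_solution omega c d L v ->
  (forall t x, 0 <= t <= L -> Cmod (u t x) <= V) -> (forall t x, 0 <= t <= L -> Cmod (v t x) <= V) ->
  forall t x, 0 <= t <= L -> v t x = u t x.
Proof.
move=> cu cv bu bv.
have V0 : 0 <= V by apply: Rle_trans (bu 0 0 _); [apply: Cmod_ge_0 | lra].
(* [K] is a Lipschitz constant of [v + v^2] on the ball of radius [V]; two components with
   constant [2 K / mu^2] each then contract by [4 K / mu^2 <= 1/2]. *)
pose K := 1 + 2 * V; pose mu := 8 * K.
have K1 : 1 <= K by rewrite /K; lra.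
have mu0 : 0 < mu by rewrite /mu; lra.
pose z t x := Cminus (v t x) (u t x).
have zb t x : 0 <= t <= L -> Cmod (z t x) <= 2 * V.
  move=> tL; have := Cmod_triangle (v t x) (Copp (u t x)); rewrite Cmod_opp.
  by have := bu t x tL; have := bv t x tL; rewrite /z /Cminus; lra.
have src t x : 0 <= t <= L -> Cmod (source u v t x) <= K * Cmod (z t x).
  move=> tL.
  have -> : source u v t x = Cmult (Cplus (RtoC 1) (Cplus (v t x) (u t x))) (z t x) by rewrite /source /z; ring.
  rewrite Cmod_mult; apply: Rmult_le_compat_r; first exact: Cmod_ge_0.
  have := Cmod_triangle (RtoC 1) (Cplus (v t x) (u t x)); rewrite Cmod_1.
  have := Cmod_triangle (v t x) (u t x); have := bu t x tL; have := bv t x tL.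
  by rewrite /K; lra.
have iter_bound k : forall t x, 0 <= t <= L -> Cmod (z t x) <= 2 * V * (1 / 2) ^ k * exp (mu * t).
  elim: k => [|k IH] t x tL.
    have : 1 <= exp (mu * t) by have := exp_ineq1_le (mu * t); nra.
    by have := zb t x tL; rewrite pow_O; nra.
  have h0 : 0 <= (1 / 2) ^ k by apply: pow_le; lra.
  pose G := K * (2 * V * (1 / 2) ^ k).
  have G0 : 0 <= G by apply: Rmult_le_pos; [lra | apply: Rmult_le_pos; lra].
  have hb s y : 0 <= s <= L -> Cmod (source u v s y) <= G * exp (mu * s).
    move=> sL; apply: Rle_trans (src s y sL) _; rewrite /G Rmult_assoc.
    by apply: Rmult_le_compat_l (IH s y sL); lra.
  have e1 := component_estimate (or_introl erefl) cu cv zb mu0 G0 hb x tL.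
  have e2 := component_estimate (or_intror erefl) cu cv zb mu0 G0 hb x tL.
  have [_ [_ e3]] := Cmod_components (z t x).
  have e0 := exp_pos (mu * t).
  have Gm : 4 * (G / mu ^ 2) <= 2 * V * (1 / 2) ^ k.+1.
    have -> : 4 * (G / mu ^ 2) = / (16 * K) * (2 * V * (1 / 2) ^ k) by rewrite /G /mu; field; lra.
    have -> : 2 * V * (1 / 2) ^ k.+1 = / 2 * (2 * V * (1 / 2) ^ k) by rewrite /=; field.
    apply: Rmult_le_compat_r; first by apply: Rmult_le_pos; lra.
    by apply: Rinv_le_contravar; lra.
  have := Rmult_le_compat_r _ _ _ (Rlt_le _ _ e0) Gm.
  by move: e1 e2 e3; rewrite /z; lra.
move=> t x tL; apply: Cmod_small_eq => e e0.
have e1 := exp_pos (mu * t).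
have W0 : 0 < 2 * V * exp (mu * t) + 1 by nra.
have half : Rabs (1 / 2) < 1 by rewrite Rabs_pos_eq; lra.
have [N hN] := pow_lt_1_zero (1 / 2) half (e / (2 * V * exp (mu * t) + 1)) (Rdiv_lt_0_compat _ _ e0 W0).
have := hN N (le_n N); have h0 : 0 < (1 / 2) ^ N by apply: pow_lt; lra.
rewrite Rabs_pos_eq; last by lra.
move=> q; apply: Rle_lt_trans (iter_bound N t x tL) _.
have -> : e = (2 * V * exp (mu * t) + 1) * (e / (2 * V * exp (mu * t) + 1)) by field; lra.
apply: Rle_lt_trans (_ : (2 * V * exp (mu * t) + 1) * (1 / 2) ^ N < _); last by apply: Rmult_lt_compat_l.
lra.
Qed.

End Uniqueness.

(** The decay estimate makes the series absolutely convergent with a uniform bound. *)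
Lemma qp_bounded nu (omega : 'I_nu -> R) L B rho u (uhat : R -> Zvec nu -> C) :
  0 < rho <= 1 -> 0 <= B -> qp_expansion omega L u uhat -> exp_decay L B (rho / 2) uhat ->
  forall t x, 0 <= t <= L -> Cmod (u t x) <= B * (6 * / rho) ^ nu.
Proof.
move=> hrho B0 hu hd t x tL; apply: (is_sum_bound (hu t x tL)) => F.
apply: Rle_trans (_ : B * rsum F (fun n => exp (- (rho / 2) * l1norm n)) <= _).
  rewrite -rsum_scal; apply: rsum_le => n.
  by rewrite Cmod_mult Cmod_cis Rmult_1_r; apply: hd.
by apply: Rmult_le_compat_l B0 (exp_decay_sum F hrho).
Qed.

Theorem theorem1p1 :
  forall (nu : nat) (omega : 'I_nu -> R) (c d : Zvec nu -> C) (A rho : R),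
    (2 <= nu)%N ->
    nonresonant omega ->
    0 < A ->
    0 < rho <= 1 ->
    (forall n, Cmod (c n) <= A * exp (- rho * l1norm n)) ->
    (forall n, Cmod (d n) <= A * exp (- rho * l1norm n)) ->
    let b := pow (6 * / rho) nu in
    let M := Rmax 1 (A * b) in
    let B := 2 * M in
    let L := 1 / (5 * M) in
    exists (u : R -> R -> C) (uhat : R -> Zvec nu -> C),
      classical_qp_solution omega c d L u uhat /\
      exp_decay L B (rho / 2) uhat /\
      (forall (v : R -> R -> C) (vhat : R -> Zvec nu -> C),
         classical_qp_solution omega c d L v vhat ->
         exp_decay L B (rho / 2) vhat ->
         forall t x, 0 <= t <= L -> v t x = u t x).
Proof.
move=> nu omega c d A rho _ _ A0 hrho hc hd b M B L.
have M1 : 1 <= M by apply: Rmax_l.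
have AM : A * b <= M by apply: Rmax_r.
have B0 : 0 <= B by rewrite /B; lra.
have L0 : 0 < L by apply: Rdiv_lt_0_compat; lra.
have sol := qseries_classical_solution omega hrho A0 M1 AM hc hd.
have expn := sol_qp_expansion (omega := omega) hrho A0 M1 AM hc hd.
have decay := sol_decay omega hrho A0 M1 AM hc hd.
exists (qseries omega (sol_coef omega c d)), (coef (sol_coef omega c d)).
split; first by split.
split=> // v vhat [vexp vsol] vdecay.
apply: (bounded_uniqueness L0 sol vsol (V := B * b)) => t x.
  exact: (qp_bounded hrho B0 expn decay).
exact: (qp_bounded hrho B0 vexp vdecay).
Qed.
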